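(* The ordered polynomial $$\overline{p}_t(K)=\begin{cases}\sum_d \mathrm{sgn}(d)\,(t^{i(d)}-1)&\text{in the unframed case}\\ \sum_d \mathrm{sgn}(d)\,t^{i(d)}&\text{in the framed case}\end{cases}$$ in $\mathbb{Z}[t,t^{-1}]$ (sums over all classical crossings $d$ of $K$) is a Vassiliev invariant of order one of long virtual knots, both in the framed and in the unframed category.
   Context: A long virtual knot diagram is an immersion $\mathbb{R}\to\mathbb{R}^2$ which coincides with the $x$-axis outside some closed ball centered at the origin and whose double points are decorated either as classical crossings (with over/under information, hence a sign $\mathrm{sgn}=\pm1$) or as virtual crossings. Long virtual knots (unframed) are diagrams modulo the classical Reidemeister moves 1, 2, 3, the purely virtual Reidemeister moves 1, 2, 3, and the mixed move (sliding an arc carrying only virtual crossings past a classical crossing). Framed long virtual knots are defined in the same way, except that classical Reidemeister move 1 is replaced by the framed Reidemeister move 1, which inserts or removes on an arc two consecutive kinks whose classical crossings have opposite signs. For a classical crossing $d$ of $K$, smooth $d$ according to orientation to obtain a two-component virtual tangle (one long component and one closed component), and forget the over/under information. Let component 1 be the long component and component 2 the closed component. For a classical crossing $x$ between the two components ($x\in1\cap2$) let $\mathrm{sgn}(x)=+1$ if the tangent vectors at $x$ (of component 1, of component 2), in this order, form a positively oriented basis of the plane, and $-1$ otherwise. The intersection index is $i(d)=\sum_{x\in1\cap2}\mathrm{sgn}(x)$. A knot invariant $\nu$ with values in an abelian group is extended to singular long virtual knots (with transverse double points, up to the classical Reidemeister moves 2, 3, the purely virtual Reidemeister moves 1, 2,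 3, the mixed move, the classical Reidemeister move 1 in the unframed category or the framed Reidemeister move 1 in the framed category, and rigid vertex isotopy) by $\nu(K_\bullet)=\nu(K_+)-\nu(K_-)$, where $K_\pm$ replace a double point by a positive/negative crossing. It is a Vassiliev (finite-type) invariant of order $\le n$ if it vanishes on all knots with more than $n$ double points; it has order one if it has order $\le1$ but is not of order $\le0$, i.e. it is nonzero on some knot with exactly one double point. *)

(* Defs.v *)
From Stdlib Require Import Relation_Operators.
From HB Require Import structures.
From mathcomp Require Import all_boot all_order all_algebra.
From mathcomp Require Import finmap.
From mathcomp Require Import all_classical all_reals all_analysis.
From mathcomp Require Import -(notations) monalg.

Set Implicit Arguments.
Unset Strict Implicit.
Unset Printing Implicit Defensive.

Import Order.TTheory GRing.Theory Num.Theory numFieldNormedType.Exports.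

Local Open Scope classical_set_scope.
Local Open Scope ring_scope.

(* C^oo: all iterated directional derivatives exist and are differentiable. *)
Definition smooth (R : realType) (V W : normedModType R) (f : V -> W) : Prop :=
  forall (vs : seq V) (x : V),
    differentiable (foldr (fun (v : V) (g : V -> W) => 'D_v g) f vs) x.

Definition diffeo (R : realType) (V : normedModType R) (h : V -> V) : Prop :=
  smooth h /\ exists g : V -> V, [/\ smooth g, cancel h g & cancel g h].

Notation plane R := (R * R)%type.

Definition det2 (R : realType) (u v : plane R) : R := u.1 * v.2 - u.2 * v.1.

(* +1 if (u, v) is a positively oriented basis, -1 if negatively oriented. *)
Definition orient (R : realType) (u v : plane R) : int := sgz (det2 u v).

(* A double point is represented by its pair of passage times s < t. *)
Definition crossings (R : realType) (f : R -> plane R) : set (R * R) :=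
  [set x | x.1 < x.2 /\ f x.1 = f x.2].

Record long_immersion (R : realType) (f : R -> plane R) : Prop := {
  li_smooth : smooth f;
  li_immersion : forall t, derive1 f t != 0;
  li_long : exists rho : R, forall t, rho < `|t| -> f t = (t, 0);
  li_finite : finite_set (crossings f);
  li_transverse : forall x, crossings f x ->
    det2 (derive1 f x.1) (derive1 f x.2) != 0;
  li_no_triple : forall s t u, s < t -> t < u -> ~ (f s = f t /\ f t = f u)
}.

(* At a classical crossing (s, t), s < t, the strand at time s passes
   over (Over) or under (Under) the strand at time t. *)
Inductive crossing := Over | Under | Virtual.

Inductive scrossing := Ordinary of crossing | DoublePoint.

(* [deco] is relevant only on the crossings of [curve]. *)
Record diagram_of (R : realType) (K : Type) := Diagram {
  curve :> R -> plane R;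
  curveP : long_immersion curve;
  deco : R * R -> K
}.

Definition redecorate (R : realType) (K L : Type) (D : diagram_of R K)
    (deco' : R * R -> L) : diagram_of R L :=
  Diagram (curveP D) deco'.

Notation diagram R := (diagram_of R crossing).
Notation sdiagram R := (diagram_of R scrossing).

Definition to_singular (R : realType) (D : diagram R) : sdiagram R :=
  redecorate D (fun x => Ordinary (deco D x)).

Definition classical (R : realType) (D : diagram R) : set (R * R) :=
  [set x | crossings D x /\ deco D x <> Virtual].

Definition double_points (R : realType) (S : sdiagram R) : set (R * R) :=
  [set x | crossings S x /\ deco S x = DoublePoint].

(* Orientation of the tangents at the crossing x, earlier strand first. *)
Definition crossing_orient (R : realType) (f : R -> plane R) (x : R * R) : int :=
  orient (derive1 f x.1) (derive1 f x.2).

(* The sign of a classical crossing is the orientation of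
   (tangent of the over-strand, tangent of the under-strand). *)
Definition crossing_sign (R : realType) (f : R -> plane R) (x : R * R)
    (c : crossing) : int :=
  match c with
  | Over => crossing_orient f x
  | Under => - crossing_orient f x
  | Virtual => 0
  end.

Definition sgn (R : realType) (D : diagram R) (d : R * R) : int :=
  crossing_sign D d (deco D d).

(* Times on the long component, resp. on the closed component, of the
   oriented smoothing at d = (d.1, d.2). *)
Definition on_long (R : realType) (d : R * R) (t : R) : Prop :=
  t < d.1 \/ d.2 < t.
Definition on_closed (R : realType) (d : R * R) (t : R) : Prop :=
  d.1 < t < d.2.

(* The classical crossings between the two components, as pairs
   (time on the long component, time on the closed component). *)
Definition mixed_crossings (R : realType) (D : diagram R) (d : R * R) :
    set (R * R) :=
  [set y | [/\ on_long d y.1, on_closed d y.2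
             & classical D y \/ classical D (y.2, y.1)]].

Definition intersection_index (R : realType) (D : diagram R) (d : R * R) : int :=
  \sum_(y \in mixed_crossings D d) orient (derive1 D y.1) (derive1 D y.2).

(* Z[t, t^-1] is the group ring of the additive group int: finitely supported
   maps int -> int, t^i being the basis element at i, in particular 1 = t^0.
   Only its abelian group structure is needed. *)
Definition laurent : zmodType := malg int int.
Definition tpow (i : int) : laurent := mkmalgU i 1.

Inductive category := Unframed | Framed.

Definition ordered_polynomial (R : realType) (cat : category) (D : diagram R) :
    laurent :=
  match cat with
  | Unframed =>
      \sum_(d \in classical D)
        ((tpow (intersection_index D d) - tpow 0) *~ sgn D d)
  | Framed =>
      \sum_(d \in classical D) (tpow (intersection_index D d) *~ sgn D d)
  end.

(* Orientation-preserving diffeomorphism of the plane with compact support. *)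
Definition planar_diffeo (R : realType) (h : plane R -> plane R) : Prop :=
  [/\ diffeo h,
      forall p, 0 < det2 ('D_((1, 0) : plane R) h p) ('D_((0, 1) : plane R) h p)
    & exists rho : R, forall p, rho < `|p| -> h p = p].

Definition isotopic (R : realType) (S S' : sdiagram R) : Prop :=
  exists (h : plane R -> plane R) (r : R -> R),
    [/\ planar_diffeo h,
        diffeo r /\ {homo r : s t / s < t},
        forall t, S' t = h (S (r t))
      & forall x, crossings S' x -> deco S' x = deco S (r x.1, r x.2)].

Definition on_arc (R : realType) (a : R * R) (t : R) : Prop := a.1 < t < a.2.

Definition dist2 (R : realType) (c p : plane R) : R :=
  (p.1 - c.1) ^+ 2 + (p.2 - c.2) ^+ 2.

(* The curve f meets the round disc of center c and radius rho exactly in the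
   n successive arcs f([(arc k).1, (arc k).2]), properly embedded at their
   ends, and has no double point on the boundary circle. *)
Record meets_disc (R : realType) (c : plane R) (rho : R) (n : nat)
    (arc : 'I_n -> R * R) (f : R -> plane R) : Prop := {
  md_radius : 0 < rho;
  md_arc : forall k, (arc k).1 < (arc k).2;
  md_sorted : forall k l : 'I_n, (k < l)%N -> (arc k).2 < (arc l).1;
  md_open : forall t, dist2 c (f t) < rho ^+ 2 <-> exists k, on_arc (arc k) t;
  md_closed : forall t, dist2 c (f t) <= rho ^+ 2 <->
    exists k, (arc k).1 <= t <= (arc k).2;
  md_boundary : forall s t, dist2 c (f s) = rho ^+ 2 -> f s = f t -> s = t
}.

(* S and S' differ only inside some disc, which they both meet in the
   arcs [arc]. *)
Definition local_change (R : realType) (n : nat) (arc : 'I_n -> R * R)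
    (S S' : sdiagram R) : Prop :=
  [/\ exists (c : plane R) (rho : R),
        meets_disc c rho arc S /\ meets_disc c rho arc S',
      forall t, ~ (exists k, on_arc (arc k) t) -> S t = S' t
    & forall x, crossings S x ->
        ~ (exists k, on_arc (arc k) x.1) -> ~ (exists k, on_arc (arc k) x.2) ->
        deco S x = deco S' x].

Definition inside (R : realType) (n : nat) (arc : 'I_n -> R * R)
    (f : R -> plane R) : set (R * R) :=
  [set x | [/\ crossings f x, exists k, on_arc (arc k) x.1
             & exists k, on_arc (arc k) x.2]].

(* Insertion on a simple arc of a kink with crossing type c: classical or
   virtual Reidemeister move 1. *)
Definition kink_move (R : realType) (c : crossing) (S S' : sdiagram R) : Prop :=
  exists (arc : 'I_1 -> R * R) (x : R * R),
    [/\ local_change arc S S',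
        inside arc S = set0,
        inside arc S' = [set x]
      & deco S' x = Ordinary c].

(* Insertion on a simple arc of two consecutive kinks whose classical
   crossings have opposite signs: framed Reidemeister move 1. *)
Definition framed_kink_move (R : realType) (S S' : sdiagram R) : Prop :=
  exists (arc : 'I_1 -> R * R) (x y : R * R) (c e : crossing),
    [/\ local_change arc S S',
        inside arc S = set0,
        inside arc S' = [set x; y] /\ x.2 < y.1,
        [/\ deco S' x = Ordinary c, deco S' y = Ordinary e,
            c <> Virtual & e <> Virtual]
      & crossing_sign S' x c = - crossing_sign S' y e].

(* The arcs 0 and 1 cross each other at exactly two points x, y, where their
   orientations are opposite, and there is no other crossing in the disc.  The
   opposite orientations are a feature of any bigon between two arcs: in the
   situations below they follow from the Jordan curve theorem. *)
Definition bigon (R : realType) (arc : 'I_2 -> R * R) (x y : R * R)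
    (f : R -> plane R) : Prop :=
  [/\ inside arc f = [set x; y], x <> y,
      on_arc (arc ord0) x.1 /\ on_arc (arc ord_max) x.2,
      on_arc (arc ord0) y.1 /\ on_arc (arc ord_max) y.2
    & crossing_orient f x = - crossing_orient f y].

(* Reidemeister move 2: classical (the same arc is over at x and at y) or
   virtual, according to c. *)
Definition bigon_move (R : realType) (S S' : sdiagram R) : Prop :=
  exists (arc : 'I_2 -> R * R) (x y : R * R) (c : crossing),
    [/\ local_change arc S S',
        inside arc S = set0,
        bigon arc x y S',
        deco S' x = Ordinary c
      & deco S' y = Ordinary c].

Definition flip (c : crossing) : crossing :=
  match c with Over => Under | Under => Over | Virtual => Virtual end.

Definition sflip (c : scrossing) : scrossing :=
  match c with Ordinary c => Ordinary (flip c) | DoublePoint => DoublePoint end.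

(* Three straight strands, pairwise crossing once: strand k is at the point
   P k + a *: v k at time m k + a, and it meets strand l at time m k + x k l. *)
Definition triangle (R : realType) (arc : 'I_3 -> R * R) (m w : 'I_3 -> R)
    (P v : 'I_3 -> plane R) (x : 'I_3 -> 'I_3 -> R) (f : R -> plane R) : Prop :=
  [/\ forall k a, `|a| < w k -> on_arc (arc k) (m k + a),
      forall k a, `|a| < w k -> f (m k + a) = P k + a *: v k,
      forall k l, k != l -> `|x k l| < w k
    & inside arc f =
        [set y | exists k l : 'I_3, (k < l)%N /\
                   y = (m k + x k l, m l + x l k)]].

(* The crossing type between strands k and l as seen from strand k: [Over]
   means that k passes over l. *)
Definition seen_from (R : realType) (S : sdiagram R) (m : 'I_3 -> R)
    (x : 'I_3 -> 'I_3 -> R) (k l : 'I_3) : scrossing :=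
  if (k < l)%N then deco S (m k + x k l, m l + x l k)
  else sflip (deco S (m l + x l k, m k + x k l)).

(* Some strand k slides past the crossing of the other two strands: it is over
   both, under both, or virtual with both.  It may slide past a virtual
   crossing only if it is itself virtual. *)
Definition slidable (col : 'I_3 -> 'I_3 -> scrossing) : Prop :=
  exists (k : 'I_3) (c : crossing),
    (forall l, l != k -> col k l = Ordinary c) /\
    (c = Virtual \/
     forall l j, l != k -> j != k -> l != j -> col l j <> Ordinary Virtual).

(* The triangle move: the three strands are translated across one another,
   keeping their directions, to the triangle obtained by the point reflection
   p |-> 2 q - p; every pair of strands keeps its crossing type.  This is
   - classical Reidemeister move 3 (three classical crossings: some strand is
     over both others as soon as the over/under pattern is not cyclic),
   - virtual Reidemeister move 3 (three virtual crossings),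
   - the mixed move (two virtual crossings on one strand),
   - the rigid vertex move sliding a strand over, under, or virtually past a
     double point. *)
Definition triangle_move (R : realType) (S S' : sdiagram R) : Prop :=
  exists (arc : 'I_3 -> R * R) (m w : 'I_3 -> R) (q : plane R)
         (P v : 'I_3 -> plane R) (x : 'I_3 -> 'I_3 -> R),
    let x' := fun k l => - x k l in
    [/\ local_change arc S S',
        triangle arc m w (fun k => q + P k) v x S,
        triangle arc m w (fun k => q - P k) v x' S',
        forall k l : 'I_3, k != l -> seen_from S m x k l = seen_from S' m x' k l
      & slidable (seen_from S m x)].

(* Rigid vertex twist: on a bigon with one double point and one classical
   crossing, half a turn of the vertex exchanges the two.  The sign of the
   classical crossing is preserved, hence the arc passing over changes. *)
Definition twist_move (R : realType) (S S' : sdiagram R) : Prop :=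
  exists (arc : 'I_2 -> R * R) (x y : R * R) (c : crossing),
    [/\ local_change arc S S' /\ (forall t, S t = S' t),
        bigon arc x y S,
        c <> Virtual,
        deco S x = DoublePoint /\ deco S y = Ordinary c
      & deco S' x = Ordinary (flip c) /\ deco S' y = DoublePoint].

Inductive move (R : realType) (cat : category) (S S' : sdiagram R) : Prop :=
  | MoveIsotopy of isotopic S S'
  | MoveR1 c of cat = Unframed & c <> Virtual & kink_move c S S'
  | MoveFramedR1 of cat = Framed & framed_kink_move S S'
  | MoveV1 of kink_move Virtual S S'
  | MoveR2 of bigon_move S S'
  | MoveR3 of triangle_move S S'
  | MoveTwist of twist_move S S'.

Definition sknot_eq (R : realType) (cat : category) :
    sdiagram R -> sdiagram R -> Prop :=
  clos_refl_sym_trans (sdiagram R) (@move R cat).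

(* Unlike in [sknot_eq], all the intermediate diagrams are nonsingular. *)
Definition knot_eq (R : realType) (cat : category) :
    diagram R -> diagram R -> Prop :=
  clos_refl_sym_trans (diagram R)
    (fun D D' => move cat (to_singular D) (to_singular D')).

Definition crossing_of_sign (R : realType) (f : R -> plane R) (x : R * R)
    (positive : bool) : crossing :=
  if (0 < crossing_orient f x) == positive then Over else Under.

(* S with the double point x replaced by a positive or negative crossing. *)
Definition resolve (R : realType) (S : sdiagram R) (x : R * R)
    (positive : bool) : sdiagram R :=
  redecorate S (fun y =>
    if y == x then Ordinary (crossing_of_sign S x positive) else deco S y).

(* Meant for diagrams without double points. *)
Definition of_singular (R : realType) (S : sdiagram R) : diagram R :=
  redecorate S (fun x => if deco S x is Ordinary c then c else Virtual).

(* nu(K_dot) = nu(K_+) - nu(K_-), for each double point in xs in turn. *)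
Fixpoint extension_along (R : realType) (A : zmodType) (nu : diagram R -> A)
    (xs : seq (R * R)) (S : sdiagram R) : A :=
  if xs is x :: xs' then
    extension_along nu xs' (resolve S x true) -
    extension_along nu xs' (resolve S x false)
  else nu (of_singular S).

Definition extension (R : realType) (A : zmodType) (nu : diagram R -> A)
    (S : sdiagram R) : A :=
  extension_along nu (fset_set (double_points S)) S.

Definition vassiliev_order_le (R : realType) (A : zmodType) (cat : category)
    (n : nat) (nu : diagram R -> A) : Prop :=
  [/\ forall D D' : diagram R, knot_eq cat D D' -> nu D = nu D',
      forall S S' : sdiagram R,
        sknot_eq cat S S' -> extension nu S = extension nu S'
    & forall S : sdiagram R,
        (n < #|` fset_set (double_points S)|)%N -> extension nu S = 0].

Definition vassiliev_order_one (R : realType) (A : zmodType) (cat : category)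
    (nu : diagram R -> A) : Prop :=
  vassiliev_order_le cat 1 nu /\ ~ vassiliev_order_le cat 0 nu.

(* Main.v *)
(* Each of the two polynomials is a sum over the crossings d of a function of
   sgn(d) and i(d).  The index is itself a sum over the crossings y, where y
   counts iff the chords of d and y are linked, and forgets over/under
   information.  A local move only affects the crossings inside its disc: in a
   kink the index is 0; in a bigon the two crossings have opposite signs and
   equal indices and their contributions to other indices cancel; in a triangle
   the indices are preserved because the three sides of the triangle add up to
   zero.  As resolving a double point x does not change any index, the extension
   to singular knots is 2 t^i(x) (or 2 (t^i(x) - 1)) when x is the only
   double point and 0 when there are more, and its invariance is again that
   of a sum over crossings.  It is nonzero on a polynomial trefoil, made
   horizontal outside a compact set, with one double point, one classical
   crossing and one virtual crossing, for which i(x) is 1 or -1. *)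
Require Import Defs.
From mathcomp Require Import all_boot all_order all_algebra.
From mathcomp Require Import finmap ring lra.
From mathcomp Require Import all_classical all_reals all_analysis.
From mathcomp Require Import -(notations) monalg.

Set Implicit Arguments.
Unset Strict Implicit.
Unset Printing Implicit Defensive.

Import Order.TTheory GRing.Theory Num.Theory numFieldNormedType.Exports.

Local Open Scope classical_set_scope.
Local Open Scope ring_scope.

(** * Index and sums over crossings *)

Lemma fsum_set2 (I : choiceType) (A : zmodType) (F : I -> A) (x y : I) :
  x <> y -> \sum_(i \in [set x; y]) F i = F x + F y.
Proof.
move=> xy; rewrite fsbigU0 ?fsbig_set1//; do ?exact: finite_set1.
by move=> i [/= -> /xy].
Qed.

Lemma fsum_set3 (I : choiceType) (A : zmodType) (F : I -> A) (x y z : I) :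
  x <> y -> x <> z -> y <> z ->
  \sum_(i \in [set x] `|` [set y; z]) F i = F x + (F y + F z).
Proof.
move=> xy xz yz; rewrite fsbigU0 ?fsbig_set1 ?fsum_set2//.
by move=> i [/= ->] [/xy|/xz].
Qed.

Lemma sgz_sub (R : realDomainType) (x y : R) :
  (x < y)%R%:R - (y < x)%R%:R = sgz (y - x) :> int.
Proof.
by case: (ltgtP x y) => [xy|yx|->]; rewrite ?subrr ?sgz0//;
  [rewrite gtr0_sgz ?subr_gt0|rewrite ltr0_sgz ?subr_lt0].
Qed.

Lemma orientC (R : realType) (u v : plane R) : orient u v = - orient v u.
Proof. by rewrite /orient -sgzN; congr sgz; rewrite /det2; ring. Qed.

Section GaussSum.
Context {R : realType}.
Implicit Types (d y : R * R) (S : sdiagram R) (f : R -> plane R).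

(** Indicator of the closed component of the smoothing at [d], integer-valued so that linking is a
    difference of two values. The inequalities are strict, so it vanishes at the two passages of [d]
    itself. *)
Definition between d (t : R) : int := (d.1 < t < d.2)%R%:R.

Definition visible (c : scrossing) : int :=
  if c is Ordinary Virtual then 0 else 1.

(* [y] contributes to the index of [d] iff the chords of [d] and [y] are
   linked; the sign records which passage of [y] is on the closed component. *)
Definition linking S d y : int :=
  (between d y.2 - between d y.1) * crossing_orient S y * visible (deco S y).

Definition gauss_index S d : int := \sum_(y \in crossings S) linking S d y.

(** Classical crossings are weighted by their sign and double points are not. With two independent
    functions [phi] and [psi], one invariance proof serves the polynomial, its extension to one
    double point, and the number of double points. *)
Definition gauss_term (A : zmodType) (phi psi : int -> A) S d : A :=
  match deco S d with
  | Ordinary c => phi (gauss_index S d) *~ crossing_sign S d c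
  | DoublePoint => psi (gauss_index S d)
  end.

Definition gauss_sum (A : zmodType) (phi psi : int -> A) S : A :=
  \sum_(d \in crossings S) gauss_term phi psi S d.

Lemma between_out d t : t <= d.1 \/ d.2 <= t -> between d t = 0.
Proof.
rewrite /between => -[|] h; first by rewrite (ltNge _ t) h.
by rewrite (ltNge t) h andbF.
Qed.

Lemma between_in d t : d.1 < t -> t < d.2 -> between d t = 1.
Proof. by rewrite /between => -> ->. Qed.

Lemma no_triple_point f (s t u : R) : long_immersion f ->
  f s = f t -> f t = f u -> s != t -> t != u -> s != u -> False.
Proof.
move=> [_ _ _ _ _ h] fst ftu; rewrite !neq_lt.
move=> /orP[a|a] /orP[b|b] /orP[c|c]; first [
  by apply: (h s t u) => //; split; congruence |
  by apply: (h s u t) => //; split; congruence |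
  by apply: (h u s t) => //; split; congruence |
  by apply: (h t s u) => //; split; congruence |
  by apply: (h t u s) => //; split; congruence |
  by apply: (h u t s) => //; split; congruence | lra ].
Qed.

(** A shared passage time would put three distinct times over one point of the plane, or else make
    the two crossings equal. *)
Lemma crossing_times_neq f d y : long_immersion f ->
  crossings f d -> crossings f y -> y <> d ->
  [/\ y.1 != d.1, y.1 != d.2, y.2 != d.1 & y.2 != d.2].
Proof.
move=> li [d12 de] [y12 ye] nyd.
have nd : d.1 != d.2 by rewrite lt_eqF.
have ny : y.1 != y.2 by rewrite lt_eqF.
have y1d1 : y.1 != d.1.
  apply/eqP => e; have [e2|n2] := eqVneq y.2 d.2.
    by apply: nyd; rewrite (surjective_pairing y) e e2 -surjective_pairing.
  apply: (no_triple_point li (esym ye) _ _ _ n2).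
  - by rewrite e.
  - by rewrite eq_sym.
  - by rewrite e.
split=> //; apply/eqP => e.
- apply: (@no_triple_point f d.1 _ _ li _ ye _ ny).
  + by rewrite e de.
  + by rewrite e.
  + by rewrite lt_eqF// (lt_trans d12)// -e.
- apply: (no_triple_point li ye _ ny).
  + by rewrite e; exact: de.
  + by rewrite e.
  + by rewrite lt_eqF// (lt_trans y12)// e.
- apply: (no_triple_point li ye _ ny _ y1d1).
  + by rewrite e de.
  + by rewrite e eq_sym.
Qed.

Lemma crossings_finite S : finite_set (crossings S).
Proof. by have [] := curveP S. Qed.

(** * Local changes: comparing two diagrams that differ inside a disc *)

Section LocalChange.
Context {n : nat} (arc : 'I_n -> R * R).

Definition off (t : R) := ~ exists k, on_arc (arc k) t.

Lemma off_arc k (t : R) : off t -> t <= (arc k).1 \/ (arc k).2 <= t.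
Proof.
move=> h; case: (leP t (arc k).1); first by left.
case: (leP (arc k).2 t); first by right.
by move=> h1 h2; case: h; exists k; apply/andP.
Qed.

Definition outside f : set (R * R) := [set x | crossings f x /\ off x.1].

(** Lying in the open disc is a property of the point, not of the time; hence the two passages of a
    crossing are both on arcs or both off them. *)
Lemma meets_disc_on c rho f s t : meets_disc c rho arc f -> f s = f t ->
  (exists k, on_arc (arc k) s) -> exists k, on_arc (arc k) t.
Proof. by move=> [_ _ _ h _ _] fst /h; rewrite fst => /h. Qed.

Lemma meets_disc_off c rho f s t : meets_disc c rho arc f -> f s = f t ->
  off s -> off t.
Proof. by move=> mf fst so /(meets_disc_on mf (esym fst)). Qed.

Lemma crossings_outside c rho f : meets_disc c rho arc f ->
  crossings f = outside f `|` inside arc f.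
Proof.
move=> mf; apply/seteqP; split => x; last by case=> [][].
move=> cx; have [h|h] := pselect (off x.1); first by left.
right; split => //; have /contrapT h' := h => //.
by apply: meets_disc_on mf _ h'; case: cx.
Qed.

Lemma disjoint_outside f : outside f `&` inside arc f `<=` set0.
Proof. by move=> x [[_ h] []]. Qed.

Lemma local_change_sym S S' : local_change arc S S' -> local_change arc S' S.
Proof.
move=> [[c [rho [m m']]] eqS eqd]; split; first by exists c, rho.
  by move=> t /eqS.
move=> x [x12 xe] o1 o2; rewrite eqd//; split => //.
by rewrite eqS// eqS.
Qed.

Lemma local_change_refl S S' : local_change arc S S' -> local_change arc S S.
Proof. by move=> [[c [rho [m m']]] eqS eqd]; split => //; exists c, rho. Qed.

Lemma derive1_near f g (t : R) : (\forall s \near t, f s = g s) ->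
  derive1 f t = derive1 g t.
Proof. by move=> h; rewrite !derive1E; apply: near_eq_derive. Qed.

(** The delicate point is the equality of tangents. By [md_boundary] no double point lies on the
    circle, so a crossing that is not inside is at distance more than [rho] from the center; by
    continuity the two curves agree near its passage times, hence so do their derivatives. *)
Lemma local_change_outside S S' x : local_change arc S S' -> outside S x ->
  [/\ outside S' x, off x.2, crossing_orient S x = crossing_orient S' x
    & deco S x = deco S' x].
Proof.
move=> [[c [rho [m m']]] eqS eqd] [[x12 xe] o1].
have o2 : off x.2 := meets_disc_off m xe o1.
have xe' : S' x.1 = S' x.2 by rewrite -!eqS.
have eqD t t' : off t -> S t = S t' -> t <> t' -> derive1 S t = derive1 S' t.
  move=> ot Stt' tt'.
  have far : rho ^+ 2 < dist2 c (S t).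
    rewrite ltNge le_eqVlt; apply/negP => /orP[/eqP E|].
      exact/tt'/(md_boundary m E).
    by move/(md_open m).
  have cS : {for t, continuous S}.
    apply: differentiable_continuous.
    by have [sm _ _ _ _ _] := curveP S; exact: (sm [::] t).
  have cd : {for t, continuous (fun u => dist2 c (S u))}.
    have c1 : {for t, continuous (fun u => (S u).1)}.
      by apply: continuous_comp cS _; exact: cvg_fst.
    have c2 : {for t, continuous (fun u => (S u).2)}.
      by apply: continuous_comp cS _; exact: cvg_snd.
    by apply: cvgD; apply: cvgM; apply: cvgB; first [exact: c1|exact: c2|exact: cvg_cst].
  apply: derive1_near.
  have : \forall s \near t, rho ^+ 2 < dist2 c (S s).
    exact: (cd _ (lt_nbhsr far)).
  apply: filterS => s; rewrite ltNge => /negP hs; apply: eqS => hk.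
  by apply: hs; apply: ltW; apply/(md_open m).
have /eqP n12 : x.1 != x.2 by rewrite lt_eqF.
have n21 : x.2 <> x.1 by move=> e; apply: n12.
split; [by split|exact: o2| |].
  by rewrite /crossing_orient (eqD _ _ o1 xe n12) (eqD _ _ o2 (esym xe) n21).
exact: eqd.
Qed.

Lemma fsum_local_change (A : zmodType) (F : R * R -> A) S S' :
  local_change arc S S' ->
  \sum_(y \in crossings S) F y =
  \sum_(y \in outside S) F y + \sum_(y \in inside arc S) F y.
Proof.
move=> [[c [rho [m _]]] _ _]; rewrite (crossings_outside m).
have fS := crossings_finite S.
rewrite fsbigU0 //; last exact: disjoint_outside.
- by apply: sub_finite_set fS => x [].
- by apply: sub_finite_set fS => x [].
Qed.

Lemma outside_eq S S' : local_change arc S S' -> outside S = outside S'.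
Proof.
move=> lc; apply/seteqP; split => x /local_change_outside => [/(_ _ lc)[]//|].
by move=> /(_ _ (local_change_sym lc))[].
Qed.

Lemma fsum_outside_linking S S' d d' : local_change arc S S' ->
  (forall t, off t -> between d t = between d' t) ->
  \sum_(y \in outside S) linking S d y =
  \sum_(y \in outside S') linking S' d' y.
Proof.
move=> lc hb; rewrite -(outside_eq lc); apply: eq_fsbigr => y.
rewrite inE => oy; have [_ o2 eo ed] := local_change_outside lc oy.
by rewrite /linking eo ed (hb _ o2) (hb _ (proj2 oy)).
Qed.

(** Crossings outside the disc see [d] and [d'] only through times off the arcs, so only the
    crossings inside need comparing. Two chords are allowed so that, taking [S' = S], the indices of
    two crossings of one diagram can be compared as well. *)
Lemma gauss_index_local S S' d d' : local_change arc S S' ->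
  (forall t, off t -> between d t = between d' t) ->
  \sum_(y \in inside arc S) linking S d y =
  \sum_(y \in inside arc S') linking S' d' y ->
  gauss_index S d = gauss_index S' d'.
Proof.
move=> lc hb hi; rewrite /gauss_index (fsum_local_change _ lc).
rewrite (fsum_local_change _ (local_change_sym lc)).
by rewrite hi (fsum_outside_linking lc hb).
Qed.

(** Invariance criterion for the moves below: the crossings inside must contribute equally to the
    index of every crossing outside, and their own terms must have the same sum. *)
Lemma gauss_sum_local (A : zmodType) (phi psi : int -> A) S S' :
  local_change arc S S' ->
  (forall d, off d.1 -> off d.2 ->
    \sum_(y \in inside arc S) linking S d y =
    \sum_(y \in inside arc S') linking S' d y) ->
  \sum_(y \in inside arc S) gauss_term phi psi S y =
  \sum_(y \in inside arc S') gauss_term phi psi S' y ->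
  gauss_sum phi psi S = gauss_sum phi psi S'.
Proof.
move=> lc hi hs; rewrite /gauss_sum (fsum_local_change _ lc).
rewrite (fsum_local_change _ (local_change_sym lc)) hs; congr (_ + _).
rewrite -(outside_eq lc); apply: eq_fsbigr => y; rewrite inE => oy.
have [_ o2 eo ed] := local_change_outside lc oy.
have ei : gauss_index S y = gauss_index S' y.
  by apply: (gauss_index_local lc (fun _ _ => erefl)); exact: hi oy.2 o2.
by rewrite /gauss_term ed ei; case: (deco S' y) => [[]|] /=; rewrite ?eo.
Qed.

(** Neither end of the interval of [d] lies in the open arc, so the indicator is constant there. *)
Lemma between_same_arc d k (s t : R) : off d.1 -> off d.2 ->
  on_arc (arc k) s -> on_arc (arc k) t -> between d s = between d t.
Proof.
move=> /(off_arc k) o1 /(off_arc k) o2 /andP[s1 s2] /andP[t1 t2].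
congr (nat_of_bool _)%:R; apply/idP/idP => /andP[? ?]; apply/andP; lra.
Qed.

Lemma between_off d d' k l (t : R) :
  on_arc (arc k) d.1 -> on_arc (arc k) d'.1 ->
  on_arc (arc l) d.2 -> on_arc (arc l) d'.2 ->
  off t -> between d t = between d' t.
Proof.
move=> /andP[? ?] /andP[? ?] /andP[? ?] /andP[? ?] o.
have := off_arc k o; have := off_arc l o.
by move=> ? ?; congr (nat_of_bool _)%:R; apply/idP/idP => /andP[? ?];
  apply/andP; lra.
Qed.

End LocalChange.

End GaussSum.

(** * Invariance under the moves *)

Section Moves.
Context {R : realType}.
Implicit Types (d y : R * R) (S : sdiagram R) (f : R -> plane R).

Lemma linking_self S d : linking S d d = 0.
Proof. by rewrite /linking !between_out ?subrr ?mul0r; auto. Qed.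

Lemma linking_same S d y : between d y.1 = between d y.2 -> linking S d y = 0.
Proof. by move=> h; rewrite /linking h subrr !mul0r. Qed.

(** The new crossing has both passages on one arc, so it links no crossing outside and has index 0.
    Its own term is a multiple of [phi 0], or 0 if it is virtual. *)
Lemma gauss_sum_kink (A : zmodType) (phi psi : int -> A) c S S' :
  phi 0 = 0 \/ c = Virtual -> kink_move c S S' ->
  gauss_sum phi psi S = gauss_sum phi psi S'.
Proof.
move=> hc [arc [x [lc i0 i1 dx]]].
have [_ [k kx] [l lx]] : inside arc S' x by rewrite i1.
move: kx lx; rewrite (ord1 k) (ord1 l) => /andP[k1 k2] /andP[l1 l2].
apply: (gauss_sum_local lc) => [d o1 o2|]; rewrite i0 i1.
  rewrite fsbig_set0 fsbig_set1 linking_same//.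
  by apply: (between_same_arc o1 o2 (k := ord0)); apply/andP.
rewrite fsbig_set0 fsbig_set1 /gauss_term dx.
case: hc => [p0|->]; last by rewrite /= mulr0z.
suff -> : gauss_index S' x = 0 by rewrite p0 mul0rz.
(* The degenerate chord [(0, 0)] has an empty closed component, hence index 0. The loop of the kink
   stays within the single arc, so times off the arc cannot distinguish [x] from this chord. *)
have <- : gauss_index S (0, 0) = 0.
  rewrite /gauss_index fsbig1// => y _; apply: linking_same.
  by rewrite !between_out//; apply/orP/le_total.
apply: (gauss_index_local (local_change_sym lc)).
  move=> t o; have := off_arc ord0 o => h.
  have z : between (0, 0) t = 0 by apply: between_out; apply/orP/le_total.
  by rewrite z between_out//; lra.
by rewrite i0 i1 fsbig_set0 fsbig_set1 linking_self.
Qed.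

(** The two loops are disjoint intervals of one arc: the kinks have equal indices and opposite
    signs, so their terms cancel for any [phi]. *)
Lemma gauss_sum_framed_kink (A : zmodType) (phi psi : int -> A) S S' :
  framed_kink_move S S' -> gauss_sum phi psi S = gauss_sum phi psi S'.
Proof.
move=> [arc [x [y [c [e [lc i0 [i1 xy] [dx dy _ _] sg]]]]]].
have [[x12 _] [k kx] [l lx]] : inside arc S' x
  by rewrite i1; left.
have [[y12 _] [k' ky] [l' ly]] : inside arc S' y
  by rewrite i1; right.
move: kx lx ky ly; rewrite !ord1.
move=> /andP[k1 k2] /andP[l1 l2] /andP[k1' k2'] /andP[l1' l2'].
have nxy : x <> y by move=> e'; move: xy y12; rewrite e'; lra.
have hx : gauss_index S' x = gauss_index S' y.
  apply: (gauss_index_local (local_change_refl (local_change_sym lc))).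
    by move=> t /(off_arc ord0) h; rewrite !between_out//=; lra.
  rewrite i1 !fsum_set2// !linking_self !linking_same//.
    by rewrite !between_out//=; lra.
  by rewrite !between_out//=; lra.
apply: (gauss_sum_local lc) => [d o1 o2|]; rewrite i0 i1.
  by rewrite fsbig_set0 fsum_set2// !linking_same ?addr0//;
    apply: (between_same_arc o1 o2 (k := ord0)); apply/andP.
by rewrite fsbig_set0 fsum_set2// /gauss_term dx dy hx sg mulrNz addNr.
Qed.

(** The chords [x] and [y] join the same two arcs, so they link the outside crossings alike.
    Exchanging their roles in their mutual linking negates the difference of indicators, which the
    opposite orientations compensate. *)
Lemma bigon_index arc x y S S' : local_change arc S S' -> bigon arc x y S ->
  visible (deco S x) = visible (deco S y) -> gauss_index S x = gauss_index S y.
Proof.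
move=> lc [i1 nxy [x1 x2] [y1 y2] o] vis.
have [[x12 xe] _ _] : inside arc S x by rewrite i1; left.
have [[y12 ye] _ _] : inside arc S y by rewrite i1; right.
have lt01 : (arc ord0).2 < (arc ord_max).1.
  by case: lc => [[c [rho [m _]]] _ _]; apply: (md_sorted m).
apply: (gauss_index_local (local_change_refl lc)).
  by move=> t; apply: between_off x1 y1 x2 y2.
rewrite i1 !fsum_set2// !linking_self addr0 add0r /linking o vis.
rewrite mulrN -mulNr; congr (_ * _ * _).
move/andP: x1 => [? ?]; move/andP: x2 => [? ?].
move/andP: y1 => [? ?]; move/andP: y2 => [? ?].
have [n1 _ _ n2] : [/\ x.1 != y.1, x.1 != y.2, x.2 != y.1 & x.2 != y.2].
  exact: (crossing_times_neq (curveP S)).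
have b1 : between x y.1 = (x.1 < y.1)%R%:R.
  by congr (nat_of_bool _)%:R; apply/andP/idP => [[]//|]; lra.
have b2 : between x y.2 = (y.2 < x.2)%R%:R.
  by congr (nat_of_bool _)%:R; apply/andP/idP => [[]//|]; lra.
have b3 : between y x.1 = (y.1 < x.1)%R%:R.
  by congr (nat_of_bool _)%:R; apply/andP/idP => [[]//|]; lra.
have b4 : between y x.2 = (x.2 < y.2)%R%:R.
  by congr (nat_of_bool _)%:R; apply/andP/idP => [[]//|]; lra.
rewrite b1 b2 b3 b4.
by case: (ltgtP x.1 y.1) n1 => // ? _; case: (ltgtP x.2 y.2) n2.
Qed.

Lemma bigon_linking arc x y d S S' : local_change arc S S' ->
  bigon arc x y S -> off arc d.1 -> off arc d.2 ->
  visible (deco S x) = visible (deco S y) ->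
  \sum_(z \in inside arc S) linking S d z = 0.
Proof.
move=> lc [i1 nxy [x1 x2] [y1 y2] o] o1 o2 vis.
rewrite i1 fsum_set2// /linking o vis (between_same_arc o1 o2 x1 y1).
by rewrite (between_same_arc o1 o2 x2 y2) mulrN mulNr addNr.
Qed.

Lemma gauss_sum_bigon (A : zmodType) (phi psi : int -> A) S S' :
  bigon_move S S' -> gauss_sum phi psi S = gauss_sum phi psi S'.
Proof.
move=> [arc [x [y [c [lc i0 b dx dy]]]]]; have lc' := local_change_sym lc.
have vis : visible (deco S' x) = visible (deco S' y) by rewrite dx dy.
apply: (gauss_sum_local lc) => [d o1 o2|].
  by rewrite i0 fsbig_set0 (bigon_linking lc' b).
have ei := bigon_index lc' b vis.
case: b => i1 nxy _ _ o; rewrite i0 i1 fsbig_set0 fsum_set2//.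
rewrite /gauss_term dx dy ei.
have -> : crossing_sign S' x c = - crossing_sign S' y c.
  by case: c {dx dy} => /=; [exact: o|rewrite o|rewrite oppr0].
by rewrite mulrNz addNr.
Qed.

(** A double point counts in indices like a classical crossing, so the twist changes no index and
    all four vertices share one. The orientations at [x] and [y] being opposite, [c] at [y] and
    [flip c] at [x] have the same sign; the two terms are merely exchanged. *)
Lemma gauss_sum_twist (A : zmodType) (phi psi : int -> A) S S' :
  twist_move S S' -> gauss_sum phi psi S = gauss_sum phi psi S'.
Proof.
move=> [arc [x [y [c [[lc eqS] b nv [dx dy] [dx' dy']]]]]].
have eC : curve S' = curve S by apply/funext => t; rewrite eqS.
have b' : bigon arc x y S' by rewrite eC.
have vc : visible (Ordinary c) = 1 by case: c nv {dy dx'}.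
have vc' : visible (Ordinary (flip c)) = 1 by case: c nv {dy dx' vc}.
have vis : visible (deco S x) = visible (deco S y) by rewrite dx dy vc.
have vis' : visible (deco S' x) = visible (deco S' y) by rewrite dx' dy' vc'.
have lc' := local_change_sym lc.
apply: (gauss_sum_local lc) => [d o1 o2|].
  by rewrite (bigon_linking lc b)// (bigon_linking lc' b').
have ei := bigon_index lc b vis; have ei' := bigon_index lc' b' vis'.
have es : gauss_index S x = gauss_index S' x.
  case: b b' => i1 nxy [x1 x2] [y1 y2] o [i1' _ _ _ _].
  apply: (gauss_index_local lc) => //.
  rewrite i1 i1' !fsum_set2// !linking_self !add0r /linking eC.
  by rewrite -vis -vis' dx dx' vc'.
case: b b' => i1 nxy _ _ o [i1' _ _ _ _].
rewrite i1 i1' !fsum_set2// /gauss_term dx dy dx' dy' -ei -ei' -es addrC eC.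
congr (_ *~ _ + _); rewrite -[RHS]/(crossing_sign S x (flip c)).
by case: c {nv dy dx' vc vc'} => /=; [rewrite o opprK|rewrite o|].
Qed.

End Moves.

(** * Invariance under the triangle move *)

Section Triangle.
Context {R : realType}.
Implicit Types (d y : R * R) (S : sdiagram R) (f : R -> plane R).

Let k0 : 'I_3 := @Ordinal 3 0 isT.
Let k1 : 'I_3 := @Ordinal 3 1 isT.
Let k2 : 'I_3 := @Ordinal 3 2 isT.

Lemma between_lo d t : t < d.2 -> between d t = (d.1 < t)%R%:R.
Proof. by rewrite /between => ->; rewrite andbT. Qed.

Lemma between_hi d t : d.1 < t -> between d t = (t < d.2)%R%:R.
Proof. by rewrite /between => ->. Qed.

Lemma visible_sflip (c : scrossing) : visible (sflip c) = visible c.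
Proof. by case: c => // -[]. Qed.

Lemma ord3_lt (k l : 'I_3) : (k < l)%N ->
  [\/ k = k0 /\ l = k1, k = k0 /\ l = k2 | k = k1 /\ l = k2].
Proof.
case: k l => [[|[|[|k]]] hk] [[|[|[|l]]] hl] // _;
  [apply: Or31|apply: Or32|apply: Or33]; by split; apply: val_inj.
Qed.

Lemma derive1_affine (p v : plane R) (a t : R) :
  derive1 (fun s : R => p + (s - a) *: v) t = v.
Proof.
apply/lim_near_cst => //; near=> h.
have h0 : h != 0 by near: h; exact: nbhs_dnbhs_neq.
rewrite opprD addrACA subrr add0r -scalerBl scalerA.
by rewrite (_ : h + t - a - (t - a) = h) ?mulVf ?scale1r//; ring.
Unshelve. all: by end_near. Qed.

(** If the sliding strand is virtual, it is either [k], and both crossings with [k] are invisible,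
    or one of [i], [j], and the crossing of [i] and [j] is virtual. If it is not virtual, all three
    crossings are visible. *)
Lemma slidable_visible (col : 'I_3 -> 'I_3 -> scrossing) (i j k : 'I_3) :
  (forall k l, k != l -> visible (col k l) = visible (col l k)) ->
  slidable col -> i != j -> i != k -> j != k ->
  visible (col i j) = 0 \/ visible (col i k) = visible (col j k).
Proof.
move=> sym [l [c [hl hc]]] ij ik jk.
have [cV|cN] := pselect (c = Virtual).
  have hv j' : l != j' -> visible (col l j') = 0.
    by move=> h; rewrite hl ?cV// eq_sym.
  have [e|n] := eqVneq l k.
    by right; rewrite (sym i k)// (sym j k)// -e !hv// e eq_sym.
  left; have [e|n'] := eqVneq l i; first by rewrite -e hv// e.
  have [e|n''] := eqVneq l j; first by rewrite sym// -e hv// e eq_sym.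
  by case: i j k l ij ik jk n n' n'' {hl hv hc sym} => [[|[|[|i]]] ?]
    [[|[|[|j]]] ?] [[|[|[|k]]] ?] [[|[|[|l]]] ?].
case: hc => // hc; right.
have hv i' j' : i' != j' -> visible (col i' j') = 1.
  move=> h; have [e|n] := eqVneq i' l.
    by rewrite e hl -?e 1?eq_sym//; case: c cN {hl}.
  have [e|n'] := eqVneq j' l.
    by rewrite sym// e hl -?e//; case: c cN {hl}.
  have := hc i' j' n n' h.
  by case: (col i' j') => [[]|].
by rewrite !hv.
Qed.

Section OneTriangle.
Variables (arc : 'I_3 -> R * R) (m w : 'I_3 -> R) (P v : 'I_3 -> plane R).
Variables (x : 'I_3 -> 'I_3 -> R) (S : sdiagram R).
Hypothesis T : triangle arc m w P v x S.

Definition vertex (k l : 'I_3) : R * R := (m k + x k l, m l + x l k).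

Lemma triangle_on k l : k != l -> on_arc (arc k) (m k + x k l).
Proof. by case: T => h _ hx _ kl; apply/h/hx. Qed.

Lemma triangle_derive k l : k != l -> derive1 S (m k + x k l) = v k.
Proof.
case: T => _ h hx _ kl.
rewrite -[RHS](derive1_affine (P k) (v k) (m k) (m k + x k l)).
apply: derive1_near.
have cn : {for m k + x k l, continuous (fun t : R => `|t - m k|)}.
  by apply: cvg_norm; apply: cvgB; [exact: cvg_id|exact: cvg_cst].
have : \forall t \near m k + x k l, `|t - m k| < w k.
  by apply: (cn _ (lt_nbhsl _)); rewrite addrC addKr hx.
by apply: filterS => t ht; rewrite -h// addrC subrK.
Qed.

Lemma triangle_inside :
  inside arc S = [set vertex k0 k1] `|` [set vertex k0 k2; vertex k1 k2].
Proof.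
case: T => _ _ _ ->; apply/seteqP; split => y /=.
  by move=> [k [l [/ord3_lt[[-> ->]|[-> ->]|[-> ->]] ->]]]; auto.
by move=> [->|[]->]; [exists k0, k1|exists k0, k2|exists k1, k2].
Qed.

Lemma triangle_orient k l : k != l ->
  crossing_orient S (vertex k l) = orient (v k) (v l).
Proof. by move=> kl; rewrite /crossing_orient !triangle_derive// eq_sym. Qed.

Lemma triangle_meet (k l : 'I_3) : (k < l)%N ->
  (P k).1 + x k l * (v k).1 = (P l).1 + x l k * (v l).1 /\
  (P k).2 + x k l * (v k).2 = (P l).2 + x l k * (v l).2.
Proof.
move=> kl; have nkl : k != l by rewrite -val_eqE /= ltn_eqF.
have [[_ /= e] _ _] : inside arc S (vertex k l).
  by case: T => _ _ _ ->; exists k, l.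
have {}e : P k + x k l *: v k = P l + x l k *: v l.
  by case: T => _ h hx _; rewrite -!h// hx// eq_sym.
by split; [have := congr1 fst e|have := congr1 snd e].
Qed.

Hypothesis sorted_arc : forall k l : 'I_3, (k < l)%N -> (arc k).2 < (arc l).1.

Let vis k l := visible (deco S (vertex k l)).

(** Two vertices of the triangle share one strand. On the third strand the indicator is fixed by the
    order of the three arcs in time; on the shared strand it records which vertex is met first. *)
Lemma triangle_linking :
  [/\ linking S (vertex k0 k1) (vertex k0 k2) =
        - (x k0 k1 < x k0 k2)%R%:R * orient (v k0) (v k2) * vis k0 k2,
      linking S (vertex k0 k1) (vertex k1 k2) =
        - (x k1 k2 < x k1 k0)%R%:R * orient (v k1) (v k2) * vis k1 k2 &
  [/\ linking S (vertex k0 k2) (vertex k0 k1) =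
        (1 - (x k0 k2 < x k0 k1)%R%:R) * orient (v k0) (v k1) * vis k0 k1,
      linking S (vertex k0 k2) (vertex k1 k2) =
        ((x k2 k1 < x k2 k0)%R%:R - 1) * orient (v k1) (v k2) * vis k1 k2,
      linking S (vertex k1 k2) (vertex k0 k1) =
        (x k1 k2 < x k1 k0)%R%:R * orient (v k0) (v k1) * vis k0 k1 &
      linking S (vertex k1 k2) (vertex k0 k2) =
        (x k2 k0 < x k2 k1)%R%:R * orient (v k0) (v k2) * vis k0 k2]].
Proof.
have a01 := sorted_arc (isT : (k0 < k1)%N).
have a02 := sorted_arc (isT : (k0 < k2)%N).
have a12 := sorted_arc (isT : (k1 < k2)%N).
have on (k l : 'I_3) : k != l -> (arc k).1 < m k + x k l < (arc k).2.
  exact: triangle_on.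
have /andP[? ?] := on k0 k1 isT; have /andP[? ?] := on k0 k2 isT.
have /andP[? ?] := on k1 k0 isT; have /andP[? ?] := on k1 k2 isT.
have /andP[? ?] := on k2 k0 isT; have /andP[? ?] := on k2 k1 isT.
rewrite /linking !triangle_orient//.
split; [| |split]; congr (_ * _ * _); rewrite /vertex /=.
- by rewrite between_out ?between_lo ?ltrD2l ?sub0r//=; lra.
- by rewrite between_out ?between_hi ?ltrD2l ?sub0r//=; lra.
- by rewrite between_in ?between_lo ?ltrD2l//=; lra.
- by rewrite between_hi ?between_in ?ltrD2l//=; lra.
- by rewrite between_lo ?between_out ?ltrD2l ?subr0//=; lra.
- by rewrite between_hi ?between_out ?ltrD2l ?subr0//=; lra.
Qed.

End OneTriangle.

(** Taking the determinant with [w] kills the right-hand side of [a u - b v = c w]. *)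
Lemma sgz_det (a b c : R) (u v w : plane R) :
  a * u.1 - b * v.1 = c * w.1 -> a * u.2 - b * v.2 = c * w.2 ->
  sgz a * orient u w = sgz b * orient v w.
Proof.
move=> e1 e2; rewrite /orient -!sgzM; congr sgz.
have {}e1 : a * u.1 = b * v.1 + c * w.1 by rewrite -[c * _]e1 addrC subrK.
have {}e2 : a * u.2 = b * v.2 + c * w.2 by rewrite -[c * _]e2 addrC subrK.
rewrite /det2; transitivity (a * u.1 * w.2 - a * u.2 * w.1); first by ring.
by rewrite e1 e2; ring.
Qed.

(** The reflection keeps directions and crossing types, and reverses the order of the two vertices
    on each strand. The index of a vertex thus changes by two sign terms, one for each other vertex,
    and these cancel because the sides of the triangle close up, provided both vertices are equally
    visible. *)
Lemma gauss_sum_triangle (A : zmodType) (phi psi : int -> A) S S' :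
  triangle_move S S' -> gauss_sum phi psi S = gauss_sum phi psi S'.
Proof.
move=> [arc [m [w [q [P [v [x [lc T T' seen slid]]]]]]]].
set x' := fun k l => - x k l in T' seen.
have sep : forall k l : 'I_3, (k < l)%N -> (arc k).2 < (arc l).1.
  by case: lc => [[c [rho [mS _]]] _ _]; apply: (md_sorted mS).
have a01 := sep k0 k1 isT; have a02 := sep k0 k2 isT.
have a12 := sep k1 k2 isT.
have on k l : k != l -> (arc k).1 < m k + x k l < (arc k).2.
  exact: (triangle_on T).
have on' k l : k != l -> (arc k).1 < m k + x' k l < (arc k).2.
  exact: (triangle_on T').
have /andP[h01 g01] := on k0 k1 isT; have /andP[h02 g02] := on k0 k2 isT.
have /andP[h10 g10] := on k1 k0 isT; have /andP[h12 g12] := on k1 k2 isT.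
have /andP[h20 g20] := on k2 k0 isT; have /andP[h21 g21] := on k2 k1 isT.
have /andP[h01' g01'] := on' k0 k1 isT; have /andP[h02' g02'] := on' k0 k2 isT.
have /andP[h10' g10'] := on' k1 k0 isT; have /andP[h12' g12'] := on' k1 k2 isT.
have /andP[h20' g20'] := on' k2 k0 isT; have /andP[h21' g21'] := on' k2 k1 isT.
pose p := vertex m x; pose p' := vertex m x'.
have dec (k l : 'I_3) : (k < l)%N -> deco S (p k l) = deco S' (p' k l).
  move=> kl; have := seen k l; rewrite /seen_from kl; apply.
  by rewrite -val_eqE /= ltn_eqF.
have n12 : p k0 k1 <> p k0 k2 by case; lra.
have n13 : p k0 k1 <> p k1 k2 by case; lra.
have n23 : p k0 k2 <> p k1 k2 by case; lra.
have n12' : p' k0 k1 <> p' k0 k2 by case; lra.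
have n13' : p' k0 k1 <> p' k1 k2 by case; lra.
have n23' : p' k0 k2 <> p' k1 k2 by case; lra.
have or (k l : 'I_3) : k != l ->
  crossing_orient S (p k l) = orient (v k) (v l).
  exact: (triangle_orient T).
have or' (k l : 'I_3) : k != l ->
  crossing_orient S' (p' k l) = orient (v k) (v l).
  exact: (triangle_orient T').
apply: (gauss_sum_local lc) => [d o1 o2|];
  rewrite (triangle_inside T) (triangle_inside T') !fsum_set3//.
  have lk (k l : 'I_3) : (k < l)%N -> linking S d (p k l) = linking S' d (p' k l).
    move=> kl; have nkl : k != l by rewrite -val_eqE /= ltn_eqF.
    have nlk : l != k by rewrite eq_sym.
    rewrite /linking (dec _ _ kl) (or _ _ nkl) (or' _ _ nkl).
    rewrite (between_same_arc o1 o2 (on k l nkl) (on' k l nkl)).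
    by rewrite (between_same_arc o1 o2 (on l k nlk) (on' l k nlk)).
  by congr (_ + (_ + _)); apply: lk.
have vis : forall i j k : 'I_3, i != j -> i != k -> j != k ->
  visible (seen_from S m x i j) = 0 \/
  visible (seen_from S m x i k) = visible (seen_from S m x j k).
  move=> i j k; apply: slidable_visible slid => i' j' ij.
  rewrite /seen_from; case: ltngtP => [||/val_inj e]; rewrite ?visible_sflip//.
  by rewrite e eqxx in ij.
(* A virtual crossing has sign 0, so its index need not be preserved; this is exactly the case left
   open by [slidable_visible]. *)
have term (k l : 'I_3) : (k < l)%N ->
  (visible (deco S (p k l)) != 0 ->
   gauss_index S (p k l) = gauss_index S' (p' k l)) ->
  gauss_term phi psi S (p k l) = gauss_term phi psi S' (p' k l).
  move=> kl; have nkl : k != l by rewrite -val_eqE /= ltn_eqF.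
  rewrite /gauss_term -(dec _ _ kl).
  have eo : crossing_orient S (p k l) = crossing_orient S' (p' k l).
    by rewrite or// or'.
  case: (deco S (p k l)) => [[]|] /= h; last by rewrite h.
  - by rewrite eo h.
  - by rewrite eo h.
  - by rewrite !mulr0z.
have [? ?] := triangle_meet T (isT : (k0 < k1)%N).
have [? ?] := triangle_meet T (isT : (k0 < k2)%N).
have [? ?] := triangle_meet T (isT : (k1 < k2)%N).
(* The three sides of the triangle, along v k0, v k1 and v k2, add up to 0;
   take the determinant with each direction in turn. *)
have E0 : sgz (x k0 k2 - x k0 k1) * orient (v k0) (v k2) =
          sgz (x k1 k2 - x k1 k0) * orient (v k1) (v k2).
  by apply: (@sgz_det _ _ (x k2 k0 - x k2 k1)); lra.
have E1 : sgz (x k0 k2 - x k0 k1) * orient (v k0) (v k1) =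
          sgz (x k2 k1 - x k2 k0) * orient (v k1) (v k2).
  rewrite (orientC (v k1)) mulrN -mulNr -sgzN.
  by apply: (@sgz_det _ _ (x k1 k2 - x k1 k0)); lra.
have E2 : sgz (x k1 k2 - x k1 k0) * orient (v k0) (v k1) =
          sgz (x k2 k1 - x k2 k0) * orient (v k0) (v k2).
  rewrite (orientC (v k0)) (orientC _ (v k2)) !mulrN; congr (- _).
  by apply: (@sgz_det _ _ (x k0 k2 - x k0 k1)); lra.
move: (triangle_linking T sep); rewrite -/p => -[L1 L2 [L3 L4 L5 L6]].
move: (triangle_linking T' sep); rewrite -/p' !ltrN2.
move=> [M1 M2 [M3 M4 M5 M6]].
(* Each sign becomes an order indicator minus the reversed one, that is, the value before the move
   against the value after it, which turns the remaining goals into linear arithmetic. *)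
move: E0 E1 E2; rewrite -!sgz_sub => E0 E1 E2.
have hb (k l : 'I_3) : k != l ->
  forall t, off arc t -> between (p k l) t = between (p' k l) t.
  move=> kl t; have lk : l != k by rewrite eq_sym.
  exact: (@between_off _ _ arc (p k l) (p' k l) k l t
    (on k l kl) (on' k l kl) (on l k lk) (on' l k lk)).
congr (_ + (_ + _)); apply: term => // nv.
- apply: (gauss_index_local lc); first exact: hb.
  rewrite (triangle_inside T) (triangle_inside T') !fsum_set3// !linking_self.
  have [e|e] := vis k0 k1 k2 isT isT isT; first by rewrite /seen_from /= e in nv.
  have {}e : visible (deco S (p k0 k2)) = visible (deco S (p k1 k2)).
    by move: e; rewrite /seen_from /= ?visible_sflip.
  rewrite L1 L2 M1 M2 -!dec// e.
  by have := congr1 ( *%R^~ (visible (deco S (p k1 k2)))) E0; rewrite /=; lra.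
- apply: (gauss_index_local lc); first exact: hb.
  rewrite (triangle_inside T) (triangle_inside T') !fsum_set3// !linking_self.
  have [e|e] := vis k0 k2 k1 isT isT isT; first by rewrite /seen_from /= e in nv.
  have {}e : visible (deco S (p k0 k1)) = visible (deco S (p k1 k2)).
    by move: e; rewrite /seen_from /= ?visible_sflip.
  rewrite L3 L4 M3 M4 -!dec// e.
  by have := congr1 ( *%R^~ (visible (deco S (p k1 k2)))) E1; rewrite /=; lra.
- apply: (gauss_index_local lc); first exact: hb.
  rewrite (triangle_inside T) (triangle_inside T') !fsum_set3// !linking_self.
  have [e|e] := vis k1 k2 k0 isT isT isT; first by rewrite /seen_from /= e in nv.
  have {}e : visible (deco S (p k0 k1)) = visible (deco S (p k0 k2)).
    by move: e; rewrite /seen_from /= ?visible_sflip.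
  rewrite L5 L6 M5 M6 -!dec// e.
  by have := congr1 ( *%R^~ (visible (deco S (p k0 k2)))) E2; rewrite /=; lra.
Qed.

End Triangle.

(** * Invariance under isotopy, and under all moves *)

Section Isotopy.
Context {R : realType}.
Implicit Types (d y : R * R) (S : sdiagram R).

Lemma det2_linear (L : {linear plane R -> plane R}) (u v : plane R) :
  det2 (L u) (L v) = det2 (L (1, 0)) (L (0, 1)) * det2 u v.
Proof.
have E (w : plane R) : L w = w.1 *: L (1, 0) + w.2 *: L (0, 1).
  rewrite -!linearZ -linearD; congr (L _); rewrite [LHS]surjective_pairing.
  by apply/pair_equal_spec; split => /=;
    rewrite /GRing.scale /= ?mulr1 ?mulr0 ?addr0 ?add0r.
have E1 (w : plane R) : (L w).1 = w.1 * (L (1, 0)).1 + w.2 * (L (0, 1)).1.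
  by rewrite {1}E.
have E2 (w : plane R) : (L w).2 = w.1 * (L (1, 0)).2 + w.2 * (L (0, 1)).2.
  by rewrite {1}E.
by rewrite /det2 (E1 u) (E1 v) (E2 u) (E2 v); ring.
Qed.

Lemma det2Z (a b : R) (u v : plane R) :
  det2 (a *: u) (b *: v) = a * b * det2 u v.
Proof. by case: u v => ? ? [? ?]; rewrite /det2 /= /GRing.scale /=; ring. Qed.

Lemma isotopic_derive S S' (h : plane R -> plane R) (r : R -> R) (t : R) :
  smooth h -> smooth r -> (forall t, S' t = h (S (r t))) ->
  derive1 S' t = r^`()%classic t *: 'd h (S (r t)) (derive1 S (r t)).
Proof.
move=> sh sr eS.
have -> : curve S' = h \o (S \o r) by apply/funext.
have dh x : differentiable h x := sh [::] x.
have dr : differentiable r t := sr [::] t.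
have dS : differentiable S (r t).
  by have [sm _ _ _ _ _] := curveP S; exact: (sm [::] (r t)).
have dSr : differentiable (S \o r) t := differentiable_comp dr dS.
have dhSr : differentiable (h \o (S \o r)) t := differentiable_comp dSr (dh _).
rewrite (derive1E' dhSr) (diff_comp dSr (dh _)) /=.
rewrite (diff_comp dr dS) /= (diff1E dS) (diff1E dr) scale1r.
by rewrite linearZ.
Qed.

(** Injectivity of [h] makes both passages meet at one point of [S], so a single differential of
    positive determinant acts on both tangents, up to the positive factors coming from [r]. *)
Lemma isotopic_orient S S' (h : plane R -> plane R) (r : R -> R) d :
  planar_diffeo h -> smooth r -> {homo r : s t / s < t} ->
  (forall t, S' t = h (S (r t))) -> S' d.1 = S' d.2 -> injective h ->
  crossing_orient S' d = crossing_orient S (r d.1, r d.2).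
Proof.
move=> [[sh _] dh _] sr hr eS ed ih.
have eSd : S (r d.1) = S (r d.2) by apply: ih; rewrite -!eS.
(* Monotonicity only gives a nonnegative derivative; it is nonzero because [S'] is an immersion. *)
have rp t : 0 < r^`()%classic t.
  have r'0 : 0 <= r^`()%classic t.
    apply: (@incr_derive1_ge0 _ _ setT); rewrite ?interiorT//.
      by move=> x _; apply/derivable1_diffP; exact: (sr [::] x).
    by move=> x y _ _; exact: hr.
  rewrite lt0r r'0 andbT.
  apply/eqP => r0; have [_ /(_ t) + _ _ _ _] := curveP S'.
  by rewrite (isotopic_derive t sh sr eS) r0 scale0r eqxx.
rewrite /crossing_orient /orient !(isotopic_derive _ sh sr eS) /= -eSd.
set L := 'd h _; set u := S^`()%classic _; set v := S^`()%classic _.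
have dp : 0 < det2 (L (1, 0)) (L (0, 1)).
  have dhp : differentiable h (S (r d.1)) := sh [::] _.
  by have := dh (S (r d.1)); rewrite (deriveE _ dhp) (deriveE _ dhp).
rewrite det2Z sgzM (gtr0_sgz (mulr_gt0 (rp _) (rp _))) mul1r (det2_linear L) sgzM.
by rewrite (gtr0_sgz dp) mul1r.
Qed.

(** Reparametrization by [r] is an order-preserving bijection between the crossings of the two
    diagrams; it respects linking, orientation and decoration, so both levels of sums are reindexed
    along it. *)
Lemma gauss_sum_isotopic (A : zmodType) (phi psi : int -> A) S S' :
  isotopic S S' -> gauss_sum phi psi S = gauss_sum phi psi S'.
Proof.
move=> [h [r [pd [[sr [g [_ rK gK]]] hr] eS eD]]].
have ih : injective h by case: pd => [[_ [k [_ /can_inj]]]].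
have mr : {mono r : s t / s < t}.
  by apply: leW_mono; apply: le_mono.
pose rho (d : R * R) := (r d.1, r d.2).
have bij : set_bij (crossings S') (crossings S) rho.
  split.
  - by move=> x [x12 xe]; split; rewrite /= ?mr//; apply: ih; rewrite -!eS.
  - by move=> [a b] [a' b'] _ _ [/(can_inj rK)-> /(can_inj rK)->].
  - move=> [a b] [ab e]; exists (g a, g b); last by rewrite /rho /= !gK.
    split; first by rewrite /= -mr !gK.
    by rewrite [(_, _).1]/= [(_, _).2]/= !eS !gK; congr h; exact: e.
have eo d : crossings S' d -> crossing_orient S' d = crossing_orient S (rho d).
  by case=> _ e; exact: (isotopic_orient pd sr hr eS e ih).
have eb d t : between (rho d) (r t) = between d t.
  by rewrite /between /= !mr.
have ei d : gauss_index S (rho d) = gauss_index S' d.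
  rewrite /gauss_index (@reindex_fsbig _ _ _ _ _ rho (crossings S') (crossings S) _ bij).
  apply: eq_fsbigr => y; rewrite inE => cy; rewrite /linking.
  by rewrite (eb d y.1) (eb d y.2) (eD _ cy) (eo _ cy).
rewrite /gauss_sum (@reindex_fsbig _ _ _ _ _ rho (crossings S') (crossings S) _ bij).
apply: eq_fsbigr => y; rewrite inE => cy; rewrite /gauss_term ei (eD _ cy) -/(rho y).
by case: (deco S (rho y)) => [[]|] /=; rewrite ?(eo _ cy).
Qed.

(** The condition [phi 0 = 0] answers the classical Reidemeister move 1, present only in the
    unframed category. *)
Lemma gauss_sum_move (A : zmodType) (phi psi : int -> A) cat S S' :
  (cat = Unframed -> phi 0 = 0) -> move cat S S' ->
  gauss_sum phi psi S = gauss_sum phi psi S'.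
Proof.
move=> h0 [].
- exact: gauss_sum_isotopic.
- by move=> c e _; apply: gauss_sum_kink; left; apply: h0.
- by move=> _; exact: gauss_sum_framed_kink.
- by apply: gauss_sum_kink; right.
- exact: gauss_sum_bigon.
- exact: gauss_sum_triangle.
- exact: gauss_sum_twist.
Qed.

End Isotopy.

(** * The polynomial as a Gauss sum, and the resolution of double points *)

Section Extension.
Context {R : realType}.
Implicit Types (d y : R * R) (S : sdiagram R) (D : diagram R).

Definition index_monomial (cat : category) (i : int) : laurent :=
  if cat is Unframed then tpow i - tpow 0 else tpow i.

(** Mixed crossings are ordered by component, crossings by time. They are split according to whether
    the earlier passage ([P1]) or the later one ([P2]) is on the long component; swapping the latter
    negates the orientation, as the difference of indicators in [linking] does. *)
Lemma intersection_indexE D d : crossings D d ->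
  intersection_index D d = gauss_index (to_singular D) d.
Proof.
move=> cd; have li := curveP D; have cf := crossings_finite (to_singular D).
have fc : finite_set (classical D) by apply: sub_finite_set cf => x [].
pose swap (y : R * R) := (y.2, y.1).
pose Q1 : set (R * R) := [set y | on_long d y.1 /\ on_closed d y.2].
pose Q2 : set (R * R) := [set y | on_long d y.2 /\ on_closed d y.1].
pose P1 := classical D `&` Q1; pose P2 := classical D `&` Q2.
rewrite /intersection_index.
have -> : mixed_crossings D d = P1 `|` swap @` P2.
  apply/seteqP; split => [[a b] [/= l c [h|h]]|[a b]].
  - by left.
  - by right; exists (b, a).
  - by move=> [[? [? ?]]|[[x y] [? [? ?]] [<- <-]]]; split => //; [left|right].
have fP2 : finite_set P2 by apply: sub_finite_set fc => x [].
pose F1 (y : R * R) := orient (derive1 D y.1) (derive1 D y.2).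
pose F2 (y : R * R) := orient (derive1 D y.2) (derive1 D y.1).
rewrite fsbigU0; first last.
- by move=> [a b] [[[[/= ab _] _] _] [[x y] [[[/= yx _] _] _] [e1 e2]]]; lra.
- exact: finite_image.
- by apply: sub_finite_set fc => x [].
transitivity (\sum_(y \in P1) F1 y + \sum_(y \in P2) F2 y).
  apply: (f_equal2 +%R erefl); apply: (@fsbig_image _ _ _ _ _ P2 swap).
  by move=> [a b] [a' b'] _ _ [-> ->].
have E1 (F : R * R -> int) : \sum_(y \in P1) F y =
  \sum_(y \in classical D) if y \in Q1 then F y else 0.
  exact: fsbig_mkcondr.
have E2 (F : R * R -> int) : \sum_(y \in P2) F y =
  \sum_(y \in classical D) if y \in Q2 then F y else 0.
  exact: fsbig_mkcondr.
apply: (eq_trans (f_equal2 +%R (E1 F1) (E2 F2))).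
apply: (eq_trans (esym (fsbig_split _ _ _ fc))); rewrite /gauss_index.

rewrite -(@fsbig_widen _ _ _ _ (classical D) (crossings D)); first last.
- move=> y [cy /not_andP[//|/contrapT e]].
  by rewrite /linking /= e mulr0.
- by move=> y [].
apply: eq_fsbigr => y; rewrite inE => -[[y12 ye] nv].
transitivity ((if y \in Q1 then F1 y else 0) + (if y \in Q2 then F2 y else 0)).
  by [].
have -> : linking (to_singular D) d y =
    (between d y.2 - between d y.1) * orient (derive1 D y.1) (derive1 D y.2).
  rewrite /linking /crossing_orient /=.
  by case: (deco D y) nv => //=; rewrite mulr1.
have [<-|nyd] := pselect (d = y).
  rewrite !memNset; last 2 first.
  - by move=> [_]; rewrite /on_closed ltxx.
  - by move=> [_]; rewrite /on_closed ltxx andbF.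
  by rewrite !between_out ?subrr ?mul0r ?addr0//; [left|right].
have [n11 n12 n21 n22] : [/\ y.1 != d.1, y.1 != d.2, y.2 != d.1 & y.2 != d.2].
  by apply: (crossing_times_neq li) => // /esym.
(* Away from the passages of [d], each time lies on exactly one component; the four combinations for
   [y.1] and [y.2] are then checked one by one. *)
have side (t : R) : t != d.1 -> t != d.2 ->
    [/\ on_closed d t, ~ on_long d t & between d t = 1] \/
    [/\ ~ on_closed d t, on_long d t & between d t = 0].
  rewrite /on_closed /on_long /between.
  case: (ltgtP d.1 t) => // h1 _; case: (ltgtP t d.2) => // h2 _ /=.
  - by left; split => // -[]; lra.
  - by right; split => //; right.
  - by right; split => //; left.
  - by right; split => //; left.
have [[c1 l1 ->]|[c1 l1 ->]] := side _ n11 n12;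
  have [[c2 l2 ->]|[c2 l2 ->]] := side _ n21 n22.
- rewrite memNset; last by case.
  rewrite memNset; last by case.
  by rewrite subrr mul0r.
- rewrite memNset; last by case.
  have -> : y \in Q2 by apply: mem_set.
  by rewrite /F2 /= (orientC (derive1 D y.2)) add0r sub0r mulN1r.
- have -> : y \in Q1 by apply: mem_set.
  rewrite memNset; last by case.
  by rewrite /F1 /= addr0 subr0 mul1r.
- rewrite memNset; last by case.
  rewrite memNset; last by case.
  by rewrite subrr mul0r.
Qed.

(** The function [psi] is arbitrary because a nonsingular diagram has no double point; virtual
    crossings enter the Gauss sum with sign 0. *)
Lemma ordered_polynomialE cat D psi :
  ordered_polynomial cat D =
  gauss_sum (index_monomial cat) psi (to_singular D).
Proof.
have -> : ordered_polynomial cat D = \sum_(d \in classical D)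
    index_monomial cat (intersection_index D d) *~ sgn D d by case: cat.
have <- : \sum_(d \in classical D)
    gauss_term (index_monomial cat) psi (to_singular D) d =
    gauss_sum (index_monomial cat) psi (to_singular D).
  apply: fsbig_widen => [y []//|y [cy /not_andP[//|/contrapT e]]].
  by rewrite /= /gauss_term /= e /= mulr0z.
apply: eq_fsbigr => d; rewrite inE => -[cd _].
by rewrite (intersection_indexE cd).
Qed.

Lemma eq_gauss_sum (A : zmodType) (phi psi : int -> A) S (g : R * R -> scrossing) :
  (forall x, crossings S x -> g x = deco S x) ->
  gauss_sum phi psi (redecorate S g) = gauss_sum phi psi S.
Proof.
move=> eg.
have ei d : gauss_index (redecorate S g) d = gauss_index S d.
  by apply: eq_fsbigr => y; rewrite inE => cy; rewrite /linking /= (eg _ cy).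
apply: eq_fsbigr => d; rewrite inE => cd.
by rewrite /gauss_term ei /= (eg _ cd).
Qed.

(** A double point and either of its resolutions are all visible, and the index ignores over/under
    information. *)
Lemma gauss_index_resolve S x b d : deco S x = DoublePoint ->
  gauss_index (resolve S x b) d = gauss_index S d.
Proof.
move=> dx; apply: eq_fsbigr => y _; rewrite /linking /=.
have [->|//] := eqVneq y x.
by rewrite dx /crossing_of_sign; case: ifP.
Qed.

(** Transversality excludes orientation 0, so one of [Over] and [Under] has each prescribed sign. *)
Lemma crossing_of_signE S x b : crossings S x ->
  crossing_sign S x (crossing_of_sign S x b) = if b then 1 else -1.
Proof.
move=> cx; have [_ _ _ _ tr _] := curveP S.
have := tr _ cx; rewrite /crossing_of_sign.
suff : det2 (S^`()%classic x.1) (S^`()%classic x.2) != 0 ->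
    (crossing_orient S x = 1 \/ crossing_orient S x = -1).
  by move=> + h => /(_ h) []; case: b => e; rewrite e /= e.
rewrite /crossing_orient /orient neq_lt => /orP[h|h].
  by right; rewrite ltr0_sgz.
by left; rewrite gtr0_sgz.
Qed.

(** Only the term of [x] differs between the two resolutions; its signs 1 and -1 add up to the
    factor 2. *)
Lemma gauss_sum_resolve (A : zmodType) (phi psi : int -> A) S x :
  double_points S x ->
  gauss_sum phi psi (resolve S x true) - gauss_sum phi psi (resolve S x false) =
  phi (gauss_index S x) *+ 2.
Proof.
move=> [cx dx]; have cf := crossings_finite S.
rewrite /gauss_sum (fsbigD1 x)// [X in _ - X](fsbigD1 x)//.
set F := gauss_term _ _ _; set G := gauss_term _ _ _.
have -> : \sum_(j \in crossings S `\ x) F j = \sum_(j \in crossings S `\ x) G j.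
  apply: eq_fsbigr => y; rewrite inE => -[_ /= /eqP/negPf nyx].
  by rewrite /F /G /gauss_term !gauss_index_resolve// /= nyx.
rewrite opprD addrACA subrr addr0 /F /G /gauss_term !gauss_index_resolve//= eqxx.
by rewrite !crossing_of_signE// mulrN1z opprK mulr1z mulr2n.
Qed.

Lemma double_points_resolve S x b y :
  double_points (resolve S x b) y <-> double_points S y /\ y <> x.
Proof.
rewrite /double_points /=; have [->|/eqP nyx] := eqVneq y x.
  by split => [[]|[]].
by split => [[]|[[]]].
Qed.

End Extension.

(** * Extension to singular diagrams *)

Section FiniteType.
Context {R : realType}.
Implicit Types (d y : R * R) (S : sdiagram R) (D : diagram R).

(** Resolving one double point leaves a function of its index alone, which no further resolution can
    change; from the second double point on the differences vanish. *)
Lemma extension_alongE (phi : int -> laurent) (nu : diagram R -> laurent) xs S :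
  (forall D, nu D = gauss_sum phi (fun=> 0) (to_singular D)) ->
  uniq xs -> (forall y, double_points S y <-> y \in xs) ->
  extension_along nu xs S =
  match xs with
  | [::] => gauss_sum phi (fun=> 0) S
  | [:: x] => phi (gauss_index S x) *+ 2
  | _ => 0
  end.
Proof.
move=> hnu; elim: xs S => [|x xs IH] S /=.
  (* No crossing is a double point here, so the default [Virtual] of [of_singular] is used only away
     from the crossings. *)
  move=> _ dS; rewrite hnu; apply: eq_gauss_sum => x cx /=.
  case e : (deco S x) => [//|].
  by have := (dS x).1 (conj cx e).
move=> /andP[xxs uxs] dS.
have Dx : double_points S x by apply/dS; rewrite mem_head.
have dR b y : double_points (resolve S x b) y <-> y \in xs.
  rewrite double_points_resolve; split => [[/dS]|yxs].
    by rewrite inE => /predU1P[].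
  split; first by apply/dS; rewrite inE yxs orbT.
  by move=> e; move: xxs; rewrite -e yxs.
(* With one further double point [y], both resolutions of [x] give the same value since the index of
   [y] is unchanged; with more, both values are already 0. *)
rewrite !IH//; case: xs {IH xxs uxs dS dR} => [|y [|//]].
- exact: gauss_sum_resolve.
- by case: Dx => _ dx; rewrite !gauss_index_resolve// subrr.
- by move=> *; rewrite subrr.
Qed.

(** Setting [phi] to 0 isolates the double points, so sums over them inherit the invariance of Gauss
    sums. *)
Lemma gauss_sum_double_points (A : zmodType) (psi : int -> A) S :
  gauss_sum (fun=> 0) psi S =
  \sum_(x <- fset_set (double_points S)) psi (gauss_index S x).
Proof.
have fd : finite_set (double_points S).
  by apply: sub_finite_set (crossings_finite S) => x [].
have <- : \sum_(x \in double_points S) gauss_term (fun=> 0) psi S x =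
    gauss_sum (fun=> 0) psi S.
  apply: fsbig_widen => [y []//|y [cy /not_andP[//|nd]]] /=.
  by rewrite /gauss_term; case: (deco S y) nd => // c _; rewrite mul0rz.
rewrite fsbig_finite//; apply: eq_big_seq => x; rewrite in_fset_set// inE.
by move=> [_ dx]; rewrite /gauss_term dx.
Qed.

Lemma double_points_number S :
  gauss_sum (fun=> 0) (fun=> 1) S = (#|` fset_set (double_points S)|%fset)%:R :> int.
Proof.
rewrite gauss_sum_double_points big_const_seq count_predT iter_addr addr0.
by rewrite cardfE cardE -?cardfE.
Qed.

(** In each case the extension is a Gauss sum or 0, which reduces its invariance to
    [gauss_sum_move]. *)
Lemma extensionE cat S :
  extension (@ordered_polynomial R cat) S =
  match #|` fset_set (double_points S)|%fset with
  | 0%N => gauss_sum (index_monomial cat) (fun=> 0) S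
  | 1%N => gauss_sum (fun=> 0) (fun i => index_monomial cat i *+ 2) S
  | _ => 0
  end.
Proof.
have fd : finite_set (double_points S).
  by apply: sub_finite_set (crossings_finite S) => x [].
have mem y : double_points S y <-> y \in (fset_set (double_points S) : seq _).
  by rewrite in_fset_set// inE.
rewrite gauss_sum_double_points /extension.
rewrite (extension_alongE (phi := index_monomial cat) _ (fset_uniq _) mem);
  last by move=> D; exact: ordered_polynomialE.
by case: (fset_set (double_points S) : seq _) => [|x [|y xs]]; rewrite ?big_seq1.
Qed.

Lemma index_monomial0 cat : cat = Unframed -> index_monomial cat 0 = 0.
Proof. by move=> ->; rewrite /= subrr. Qed.

Lemma vassiliev_order_le_one cat :
  vassiliev_order_le cat 1 (@ordered_polynomial R cat).
Proof.
split.
- move=> D D'; elim=> [{}D {}D' m|//|{}D {}D' _ -> //|D1 D2 D3 _ -> _ -> //].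
  rewrite !(ordered_polynomialE _ _ (fun=> 0)).
  by apply: gauss_sum_move m; exact: index_monomial0.
- move=> S S'; elim=> [{}S {}S' m|//|{}S {}S' _ -> //|S1 S2 S3 _ -> _ -> //].
  rewrite !extensionE.
  (* The number of double points is itself a Gauss sum, with [phi = 0] and [psi = 1]; hence both
     diagrams fall under the same case of [extensionE]. *)
  have [/eqP] : (#|` fset_set (double_points S)|%fset)%:R =
      (#|` fset_set (double_points S')|%fset)%:R :> int.
    by rewrite -!double_points_number; apply: gauss_sum_move m.
  rewrite eqr_nat => /eqP ->.
  rewrite (gauss_sum_move _ (@index_monomial0 cat) m).
  by rewrite (gauss_sum_move _ _ m).
- move=> S; rewrite extensionE.
  by case: (#|` _|%fset) => [|[|n]].
Qed.

(** The coefficient at [i] is 2: the constant term subtracted in the unframed case sits at 0, away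
    from [i]. *)
Lemma index_monomial_neq0 cat (i : int) : i != 0 -> index_monomial cat i *+ 2 != 0.
Proof.
move=> i0; apply/eqP => /(congr1 (monalg.mcoeff i)).
rewrite monalg.mcoeffMn monalg.mcoeff0.
suff -> : monalg.mcoeff i (index_monomial cat i) = 1 by [].
case: cat => /=; rewrite /tpow ?monalg.mcoeffB !monalg.mcoeffU eqxx//.
by rewrite eq_sym (negbTE i0).
Qed.

Lemma vassiliev_not_order_le_zero cat S x :
  double_points S = [set x] -> gauss_index S x != 0 ->
  ~ vassiliev_order_le cat 0 (@ordered_polynomial R cat).
Proof.
move=> dS i0 [_ _ /(_ S)]; rewrite extensionE gauss_sum_double_points.
rewrite dS fset_set1 cardfs1 => /(_ isT); rewrite big_seq_fset1 => /eqP.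
by rewrite (negbTE (index_monomial_neq0 cat i0)).
Qed.

End FiniteType.

(** * A singular trefoil diagram *)

Section FlatFunctions.
Context {R : realType}.
Implicit Types (f g : R -> R) (x t : R) (k : nat).

(** For [k = 0] this is the usual smooth flat function; the exponent [k] makes the span of the
    family closed under differentiation. *)
Definition flat k x : R := if 0 < x then x^-1 ^+ k * expR (- x^-1) else 0.

Lemma flat_le0 k x : x <= 0 -> flat k x = 0.
Proof. by rewrite /flat ltNge => ->. Qed.

Lemma flat_gt0 k x : 0 < x -> 0 < flat k x.
Proof. by move=> x0; rewrite /flat x0 mulr_gt0 ?exprn_gt0 ?invr_gt0 ?expR_gt0. Qed.

Lemma flat_ge0 k x : 0 <= flat k x.
Proof. by case: (ltP 0 x) => x0; [exact/ltW/flat_gt0|rewrite flat_le0]. Qed.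

(** With [y = 1 / x], the exponential of [y] is at least its Taylor term of degree [k + 2]. The
    quadratic bound yields the zero derivative at 0. *)
Lemma flat_le k x : flat k x <= k.+2`!%:R * x ^+ 2.
Proof.
case: (ltP 0 x) => x0; last by rewrite flat_le0// mulr_ge0 ?sqr_ge0.
rewrite /flat x0 expRN -[leLHS]/(_ / _) ler_pdivrMr ?expR_gt0//.
set y := x^-1; have y0 : 0 < y by rewrite invr_gt0.
have /(le_trans _) h := @expR_ge1Dxn R y k.+1 (ltW y0).
have {h} : y ^+ k.+2 / k.+2`!%:R <= expR y by apply: h; rewrite lerDr.
rewrite ler_pdivrMr ?ltr0n ?fact_gt0// => h.
have -> : y ^+ k = y ^+ k.+2 * x ^+ 2.
  by rewrite -addn2 exprD -mulrA -exprMn mulVf ?gt_eqF// expr1n mulr1.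
by rewrite [leRHS]mulrAC ler_pM2r ?exprn_gt0// mulrC.
Qed.

Lemma is_derive_flat k x :
  is_derive x 1 (flat k) (flat k.+2 x - k%:R * flat k.+1 x).
Proof.
case: (ltgtP x 0) => x0.
- rewrite !(flat_le0 _ (ltW x0)) mulr0 subr0.
  apply: near_eq_is_derive (is_derive_cst 0 x 1).
  by near=> y; rewrite flat_le0// ltW//; near: y; exact: lt_nbhsl.
- have dV : is_derive x 1 (fun y : R => y^-1) (- x^-1 ^+ 2).
    have := @is_deriveV _ id x 1 1; rewrite gt_eqF// => /(_ isT (is_derive_id _ _)).
    by rewrite exprVn scaler1.
  have dX := is_deriveX k dV.
  have dE := @is_derive1_comp _ expR (fun y => - y^-1) x _ _
    (is_derive_expR _) (is_deriveN dV).
  have := is_deriveM dX dE; set d := (X in is_derive _ _ _ X) => dM.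
  have -> : flat k.+2 x - k%:R * flat k.+1 x = d.
    rewrite /d /flat x0 /GRing.scale /= !fctE /=; case: (k) => [|n].
      by rewrite !expr0 !mul0r; ring.
    by rewrite /= !exprS; ring.
  apply: near_eq_is_derive dM; near=> y.
  have y0 : 0 < y by near: y; exact: lt_nbhsr.
  by rewrite /flat y0 !fctE.
- rewrite x0 !flat_le0// mulr0 subr0.
  suff cv : h^-1 *: ((flat k \o shift 0) (h *: 1) - flat k 0) @[h --> (0 : R)^'] --> (0 : R).
    by apply: DeriveDef; [exact: cvgP cv|exact: cvg_lim cv].
  pose C : R := k.+2`!%:R.
  have C0 : 0 < C by rewrite ltr0n fact_gt0.
  apply/cvgrPdist_lt => e e0; near=> h.
  have h0 : h != 0 by near: h; exact: nbhs_dnbhs_neq.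
  have he : `|h| < e / C by near: h; apply: dnbhs0_lt; rewrite divr_gt0.
  rewrite sub0r normrN /= addr0 (flat_le0 k (lexx 0)) subr0 /GRing.scale /= mulr1.
  rewrite normrM normfV (ger0_norm (flat_ge0 _ _)) mulrC.
  rewrite ltr_pdivrMr ?normr_gt0//; apply: (le_lt_trans (flat_le k h)).
  rewrite -/C -real_normK ?num_real// expr2 mulrA ltr_pM2r ?normr_gt0//.
  by rewrite mulrC -ltr_pdivlMr.
Unshelve. all: by end_near. Qed.

(** A syntactic class containing its own derivatives, so that smoothness follows by induction on the
    number of differentiations. Inversion is restricted to nowhere vanishing functions. *)
Inductive elementary : (R -> R) -> Prop :=
  | ElementaryConst c : elementary (fun=> c)
  | ElementaryId : elementary id
  | ElementaryFlat k : elementary (flat k)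
  | ElementaryAdd f g :
      elementary f -> elementary g -> elementary (fun x => f x + g x)
  | ElementaryMul f g :
      elementary f -> elementary g -> elementary (fun x => f x * g x)
  | ElementaryInv f :
      (forall x, f x != 0) -> elementary f -> elementary (fun x => (f x)^-1)
  | ElementaryComp f g :
      elementary f -> elementary g -> elementary (fun x => f (g x)).

Lemma elementary_derive f : elementary f ->
  exists2 g, elementary g & forall x, is_derive x 1 f (g x).
Proof.
elim=> {f} [c||k|f g _ [f' ef df] _ [g' eg dg]|f g ef' [f' ef df] eg' [g' eg dg]
    |f f0 ef' [f' ef df]|f g ef' [f' ef df] eg' [g' eg dg]].
- by exists (fun=> 0); [exact: ElementaryConst|move=> x; exact: is_derive_cst].
- by exists (fun=> 1); [exact: ElementaryConst|move=> x; exact: is_derive_id].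
- exists (fun x => flat k.+2 x + (- k%:R) * flat k.+1 x).
    by apply: ElementaryAdd; [|apply: ElementaryMul; [exact: ElementaryConst|]];
      exact: ElementaryFlat.
  by move=> x; rewrite mulNr; exact: is_derive_flat.
- exists (fun x => f' x + g' x); first exact: ElementaryAdd.
  by move=> x; exact: is_deriveD (df x) (dg x).
- exists (fun x => f x * g' x + g x * f' x).
    by apply: ElementaryAdd; apply: ElementaryMul.
  by move=> x; exact: is_deriveM (df x) (dg x).
- exists (fun x => (-1 * ((f x)^-1 * (f x)^-1)) * f' x).
    have ei := ElementaryInv f0 ef'.
    by do ![apply: ElementaryMul => //|exact: ElementaryConst].
  move=> x; have := is_deriveV (f0 x) (df x).
  by rewrite -exprVn expr2 mulN1r.
- exists (fun x => f' (g x) * g' x).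
    by apply: ElementaryMul => //; apply: ElementaryComp.
  by move=> x; exact: is_derive1_comp (df (g x)) (dg x).
Qed.

Lemma elementary_differentiable f x : elementary f -> differentiable f x.
Proof.
by case/elementary_derive => g _ /(_ x) [dv _]; apply/derivable1_diffP.
Qed.

Lemma elementary_smooth f g : elementary f -> elementary g ->
  smooth (fun t : R => (f t, g t) : plane R).
Proof.
move=> ef eg vs x.
suff [a [b [ea eb ->]]] : exists a b : R -> R, [/\ elementary a, elementary b &
    foldr (fun (v : R) (h : R -> plane R) => 'D_v h)
      (fun t : R => (f t, g t) : plane R) vs =
    (fun t : R => (a t, b t) : plane R)].
  by apply: differentiable_pair; exact: elementary_differentiable.
elim: vs => [|v vs [a [b [ea eb IH]]]]; first by exists f, g.
have [a' ea' da] := elementary_derive ea.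
have [b' eb' db] := elementary_derive eb.
exists (fun t => v * a' t), (fun t => v * b' t); split.
- by apply: ElementaryMul => //; exact: ElementaryConst.
- by apply: ElementaryMul => //; exact: ElementaryConst.
rewrite [LHS]/= IH; apply/funext => t.
have dat := elementary_differentiable t ea.
have dbt := elementary_differentiable t eb.
rewrite (deriveE _ (differentiable_pair dat dbt)) (diff_pair dat dbt).
rewrite (diff1E dat) (diff1E dbt) !derive1E.
by have [_ ->] := da t; have [_ ->] := db t.
Qed.

Lemma derive1_pair f g x (df dg : R) : is_derive x 1 f df -> is_derive x 1 g dg ->
  derive1 (fun t : R => (f t, g t) : plane R) x = (df, dg).
Proof.
move=> [/derivable1_diffP df1 <-] [/derivable1_diffP dg1 <-].
rewrite (derive1E' (differentiable_pair df1 dg1)) (diff_pair df1 dg1).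
by rewrite -!deriveE.
Qed.

End FlatFunctions.

(** * A cutoff function and the long trefoil curve *)

Section Trefoil.
Context {R : realType}.
Implicit Types (s t x : R).

(** The product of a smooth step in [3 - t] and one in [3 + t]. For [|t|] at least 2 one factor is
    constantly 1 nearby on that side, which gives the sign of the derivative. *)
Lemma cutoff_exists : exists chi chi' : R -> R,
  [/\ elementary chi, forall t, is_derive t 1 chi (chi' t),
      forall t, `|t| <= 2 -> chi t = 1 /\ chi' t = 0,
      forall t, 3 <= `|t| -> chi t = 0 /\ chi' t = 0 &
  [/\ forall t, 0 <= chi t <= 1,
      forall t, 2 <= t -> chi' t <= 0
    & forall t, t <= -2 -> 0 <= chi' t]].
Proof.
pose den x := flat 0 x + flat 0 (1 + (-1) * x).
have den_gt0 x : 0 < den x.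
  rewrite /den; case: (ltP 0 x) => x0.
    by rewrite ltr_pwDl ?flat_gt0 ?flat_ge0.
  by rewrite ltr_wpDl ?flat_ge0// flat_gt0//; lra.
have den_neq0 x : den x != 0 by rewrite gt_eqF.
pose step x := flat 0 x * (den x)^-1.
have step0 x : x <= 0 -> step x = 0 by move=> x0; rewrite /step flat_le0// mul0r.
have step1 x : 1 <= x -> step x = 1.
  move=> x1; have e : den x = flat 0 x.
    by rewrite /den [X in _ + X]flat_le0 ?addr0//; lra.
  by rewrite /step -e mulfV.
have step_itv x : 0 <= step x <= 1.
  rewrite /step divr_ge0 ?flat_ge0 ?(ltW (den_gt0 x))//=.
  by rewrite ler_pdivrMr// mul1r lerDl flat_ge0.
have edge (a b : R) : elementary (fun x => a + b * x).
  by apply: ElementaryAdd; [exact: ElementaryConst|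
    apply: ElementaryMul; [exact: ElementaryConst|exact: ElementaryId]].
have estep : elementary step.
  apply: ElementaryMul; first exact: ElementaryFlat.
  apply: ElementaryInv => //; apply: ElementaryAdd; first exact: ElementaryFlat.
  by apply: (@ElementaryComp _ (flat 0) (fun x => 1 + (-1) * x));
    [exact: ElementaryFlat|exact: edge].
(* The quotient rule for [step], simplified so that nonnegativity is visible; the derivative of
   [flat 0] is [flat 2]. *)
pose step' x := (flat 2 x * flat 0 (1 + (-1) * x) +
  flat 0 x * flat 2 (1 + (-1) * x)) / den x ^+ 2.
have di x : is_derive x 1 (fun y : R => y) 1 := is_derive_id x 1.
have dc (c x : R) : is_derive x 1 (fun=> c) 0 := is_derive_cst c x 1.
have daff (a b x : R) : is_derive x 1 (fun x => a + b * x) b.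
  apply: is_derive_eq (is_deriveD (dc a x) (is_deriveM (dc b x) (di x))) _.
  by rewrite scaler0 addr0 add0r /GRing.scale /= mulr1.
have dstep x : is_derive x 1 step (step' x).
  have d1 := is_derive_flat 0 x.
  have d2 := @is_derive1_comp _ (flat 0) _ x _ _ (is_derive_flat 0 _) (daff 1 (-1) x).
  have d3 := is_deriveD d1 d2.
  have d4 := @is_deriveV _ den x _ _ (den_neq0 x) d3.
  apply: is_derive_eq (is_deriveM d1 d4) _.
  rewrite /GRing.scale /= !mul0r !subr0 /step'.
  have := den_neq0 x; rewrite /den; set u := flat 0 x; set v := flat 0 _.
  by move=> ?; field.
have step'0 x : x <= 0 \/ 1 <= x -> step' x = 0.
  rewrite /step' => -[h|h]; first by rewrite !(flat_le0 _ h) !mul0r addr0 mul0r.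
  have h' : 1 + (-1) * x <= 0 by lra.
  by rewrite !(flat_le0 _ h') !mulr0 addr0 mul0r.
have step'_ge0 x : 0 <= step' x.
  by rewrite /step' divr_ge0 ?sqr_ge0// addr_ge0// mulr_ge0 ?flat_ge0.
pose chi t := step (3 + (-1) * t) * step (3 + 1 * t).
pose chi' t := step (3 + (-1) * t) * (step' (3 + 1 * t) * 1) +
  step (3 + 1 * t) * (step' (3 + (-1) * t) * (-1)).
exists chi, chi'; split.
- by apply: ElementaryMul; apply: (@ElementaryComp _ step).
- move=> t.
  have d1 := @is_derive1_comp _ step _ t _ _ (dstep _) (daff 3 (-1) t).
  have d2 := @is_derive1_comp _ step _ t _ _ (dstep _) (daff 3 1 t).
  exact: is_deriveM d1 d2.
- move=> t; rewrite ler_norml => /andP[t1 t2].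
  have h1 : 1 <= 3 + (-1) * t by lra.
  have h2 : 1 <= 3 + 1 * t by lra.
  rewrite /chi /chi' !step1// !step'0; [|by right..].
  by rewrite !mul0r !mulr0 addr0 mulr1.
- move=> t; rewrite ler_normr => /orP[t3|t3].
    have h : 3 + (-1) * t <= 0 by lra.
    rewrite /chi /chi' (step0 _ h) (step'0 (3 + (-1) * t)); last by left.
    by rewrite !mul0r mulr0 addr0.
  have h : 3 + 1 * t <= 0 by lra.
  rewrite /chi /chi' (step0 _ h) (step'0 (3 + 1 * t)); last by left.
  by rewrite !mul0r !mulr0 addr0.
- split=> t.
  + have /andP[? ?] := step_itv (3 + (-1) * t).
    have /andP[? ?] := step_itv (3 + 1 * t).
    by rewrite /chi mulr_ge0//= mulr_ile1.
  + move=> t2; rewrite /chi' (step'0 (3 + 1 * t)); last by right; lra.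
    rewrite mul0r mulr0 add0r mulrN1 mulrN oppr_le0 mulr_ge0//.
    by have /andP[] := step_itv (3 + 1 * t).
  + move=> t2; rewrite /chi' (step'0 (3 + (-1) * t)); last by right; lra.
    rewrite mul0r mulr0 addr0 mulr1 mulr_ge0//.
    by have /andP[] := step_itv (3 + (-1) * t).
Qed.

Lemma increasing_gt (f f' : R -> R) (a b : R) : a < b ->
  (forall t, is_derive t 1 f (f' t)) ->
  (forall t, a < t < b -> 0 < f' t) -> f a < f b.
Proof.
move=> ab df pos.
have dv t : derivable f t 1 by case: (df t).
apply: (@gtr0_derive1_incr _ f a b) => //.
- by move=> t; rewrite in_itv /= => h; rewrite derive1E; case: (df t) => _ ->; exact: pos.
- by apply: derivable_within_continuous => t _.
Qed.

(* Up to rescaling, the middle part is Shastri's polynomial trefoil. *)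
Lemma trefoil_exists : exists X Y X' Y' : R -> R,
  [/\ elementary X, elementary Y,
      forall t, is_derive t 1 X (X' t), forall t, is_derive t 1 Y (Y' t) &
  [/\ forall t, 3 < `|t| -> X t = t /\ Y t = 0,
      forall t, `|t| <= 2 ->
        [/\ X t = (t ^+ 3 - 3 * t) / 9, Y t = t ^+ 4 - 4 * t ^+ 2,
            X' t = (t ^+ 2 - 1) / 3 & Y' t = 4 * t ^+ 3 - 8 * t] &
      forall t, 2 <= `|t| -> 0 < X' t]].
Proof.
have [chi [chi' [echi dchi chi1 chi0 [chi_itv chi_le chi_ge]]]] := cutoff_exists.
(* [P] is the trefoil abscissa [(t^3 - 3 t) / 9] minus [t], so that [t + chi t * P t] passes from
   the trefoil to the straight line. *)
pose P t : R := 9^-1 * (t * (t * t)) + (- (4 / 3)) * t.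
pose Q t : R := (t * t) * (t * t) + (-4) * (t * t).
pose P' t : R := 3^-1 * (t * t) - 4 / 3.
pose Q' t : R := 4 * (t * (t * t)) - 8 * t.
have ec c : elementary (fun=> c : R) := ElementaryConst c.
have ei : elementary (id : R -> R) := @ElementaryId R.
have e2 : elementary (fun t : R => t * t) := ElementaryMul ei ei.
have eP : elementary P.
  exact: ElementaryAdd (ElementaryMul (ec _) (ElementaryMul ei e2))
    (ElementaryMul (ec _) ei).
have eQ : elementary Q.
  exact: ElementaryAdd (ElementaryMul e2 e2) (ElementaryMul (ec _) e2).
have di t : is_derive t 1 (fun y : R => y) 1 := is_derive_id t 1.
have dc (c t : R) : is_derive t 1 (fun=> c) 0 := is_derive_cst c t 1.
have d2 t := is_deriveM (di t) (di t).
have dP t : is_derive t 1 P (P' t).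
  apply: is_derive_eq (is_deriveD (is_deriveM (dc 9^-1 t)
    (is_deriveM (di t) (d2 t))) (is_deriveM (dc (- (4 / 3)) t) (di t))) _.
  rewrite /P' !fctE /GRing.scale /=.
  by field.
have dQ t : is_derive t 1 Q (Q' t).
  apply: is_derive_eq (is_deriveD (is_deriveM (d2 t) (d2 t))
    (is_deriveM (dc (-4) t) (d2 t))) _.
  by rewrite /Q' !fctE /GRing.scale /=; ring.
exists (fun t => t + chi t * P t), (fun t => chi t * Q t).
exists (fun t => 1 + (chi t * P' t + P t * chi' t)).
exists (fun t => chi t * Q' t + Q t * chi' t); split.
- exact: ElementaryAdd ei (ElementaryMul echi eP).
- exact: ElementaryMul echi eQ.
- by move=> t; exact: is_deriveD (di t) (is_deriveM (dchi t) (dP t)).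
- by move=> t; exact: is_deriveM (dchi t) (dQ t).
- split=> t h.
  + by have [-> _] := chi0 t (ltW h); rewrite !mul0r addr0.
  + have [-> ->] := chi1 t h; rewrite /P /Q /P' /Q'.
    by split; field.
  + have /andP[c0 c1] := chi_itv t.
    have h4 : 4 <= t ^+ 2.
      by rewrite -real_normK ?num_real// (_ : 4 = 2 ^+ 2) ?ler_pXn2r ?nnegrE//; ring.
    (* For [2 <= |t| < 3] both factors have the sign opposite to [t] or vanish, since
       [t^2 <= 9 < 12]; beyond 3 the cutoff is constant. *)
    have PC : 0 <= P t * chi' t.
      have [t3|t3] := leP 3 `|t|; first by have [_ ->] := chi0 t t3; rewrite mulr0.
      have h9 : t ^+ 2 <= 9.
        rewrite -real_normK ?num_real// (_ : 9 = 3 ^+ 2); last by ring.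
        by rewrite ler_pXn2r ?nnegrE// ltW.
      have -> : P t = 9^-1 * (t ^+ 2 - 12) * t by rewrite /P; field.
      move: h; rewrite ler_normr => /orP[h|h].
        have := chi_le t h => ?.
        by rewrite -mulrNN mulr_ge0 ?oppr_ge0// mulr_le0_ge0//; nra.
      have h' : t <= -2 by lra.
      have ? := chi_ge t h'.
      by apply: mulr_ge0 => //; nra.
    have : 1 <= 1 + chi t * P' t + 0 * P t -> 0 < 1 + (chi t * P' t + P t * chi' t) by lra.
    apply; rewrite mul0r addr0 lerDl mulr_ge0// /P' -expr2; lra.
Qed.

End Trefoil.

(** * Double points of the trefoil and the singular diagram *)

Section TrefoilDiagram.
Context {R : realType}.
Implicit Types (s t : R).

(* After division by [t - s] the equations read [s^2 + s t + t^2 = 3] and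
   [(s + t) (s^2 + t^2 - 4) = 0]. *)
Lemma trefoil_double_points s t : s < t ->
  s ^+ 3 - 3 * s = t ^+ 3 - 3 * t ->
  s ^+ 4 - 4 * s ^+ 2 = t ^+ 4 - 4 * t ^+ 2 ->
  (s = - t /\ t ^+ 2 = 3) \/ (s * t = -1 /\ s ^+ 2 + t ^+ 2 = 4).
Proof.
move=> st e1 e2; have ts0 : t - s != 0 by rewrite subr_eq0 gt_eqF.
have q : s ^+ 2 + s * t + t ^+ 2 = 3.
  apply: (mulfI ts0); transitivity (t ^+ 3 - s ^+ 3); first by ring.
  lra.
have : (t - s) * ((s + t) * (s ^+ 2 + t ^+ 2 - 4)) = 0.
  transitivity ((t ^+ 4 - 4 * t ^+ 2) - (s ^+ 4 - 4 * s ^+ 2)); first by ring.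
  by rewrite e2 subrr.
move=> /eqP; rewrite mulf_eq0 (negbTE ts0) /= mulf_eq0 => /orP[/eqP h|/eqP h].
  have hs : s = - t by lra.
  by left; split => //; move: q; rewrite hs => q; lra.
by right; split; lra.
Qed.

(** The determinant factors so that the equations evaluate it: it is [16 t / 3] in the first case
    and [- 8 (t - s) / 3] in the second. *)
Lemma trefoil_transverse s t : s < t ->
  (s = - t /\ t ^+ 2 = 3) \/ (s * t = -1 /\ s ^+ 2 + t ^+ 2 = 4) ->
  (s ^+ 2 - 1) / 3 * (4 * t ^+ 3 - 8 * t) -
  (4 * s ^+ 3 - 8 * s) * ((t ^+ 2 - 1) / 3) != 0.
Proof.
move=> st [[-> t2]|[p q]].
  have -> : ((- t) ^+ 2 - 1) / 3 * (4 * t ^+ 3 - 8 * t) -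
    (4 * (- t) ^+ 3 - 8 * - t) * ((t ^+ 2 - 1) / 3) =
    (t ^+ 2 - 1) * (8 * (t ^+ 2) - 16) * t / 3 by field.
  have t0 : t != 0 by apply/eqP => t0; move: t2; rewrite t0; lra.
  by rewrite t2 !mulf_neq0 ?invr_eq0//; apply/eqP; lra.
have -> : (s ^+ 2 - 1) / 3 * (4 * t ^+ 3 - 8 * t) -
  (4 * s ^+ 3 - 8 * s) * ((t ^+ 2 - 1) / 3) =
  4 / 3 * (t - s) * ((s * t) ^+ 2 + 2 * (s * t) + 2 -
    (s ^+ 2 + t ^+ 2 + s * t)) by field.
rewrite p q; apply/eqP => h; have : t - s = 0 by lra.
lra.
Qed.

(** In the second case [(t - s)^2 = 6] and [(s + t)^2 = 2]; the order fixes [t - s = b], and the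
    sign of [s + t] separates the two solutions. *)
Lemma trefoil_parameters s t (a b c : R) : s < t ->
  0 < a -> 0 < b -> 0 < c -> a ^+ 2 = 2 -> b ^+ 2 = 6 -> c ^+ 2 = 3 ->
  (s = - t /\ t ^+ 2 = 3) \/ (s * t = -1 /\ s ^+ 2 + t ^+ 2 = 4) ->
  [\/ (s, t) = ((- b - a) / 2, (b - a) / 2),
      (s, t) = (- c, c) | (s, t) = ((a - b) / 2, (a + b) / 2)].
Proof.
move=> st a0 b0 c0 a2 b2 c2 [[e t2]|[p q]].
  have : t ^+ 2 == c ^+ 2 by rewrite t2 c2.
  by rewrite eqf_sqr => /orP[] /eqP h; [apply: Or32; rewrite e h|lra].
have tb : t - s = b.
  have : (t - s) ^+ 2 == b ^+ 2.
    by rewrite b2; apply/eqP; transitivity (s ^+ 2 + t ^+ 2 - 2 * (s * t)); [ring|lra].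
  by rewrite eqf_sqr => /orP[] /eqP h; lra.
have : (s + t) ^+ 2 == a ^+ 2.
  by rewrite a2; apply/eqP; transitivity (s ^+ 2 + t ^+ 2 + 2 * (s * t)); [ring|lra].
rewrite eqf_sqr => /orP[] /eqP h; [apply: Or33|apply: Or31]; congr (_, _); lra.
Qed.

Lemma trefoil_vertex s t : s * t = -1 -> s ^+ 2 + t ^+ 2 = 4 ->
  s ^+ 3 - 3 * s = t ^+ 3 - 3 * t /\
  s ^+ 4 - 4 * s ^+ 2 = t ^+ 4 - 4 * t ^+ 2.
Proof.
move=> p q; split; apply/eqP; rewrite -subr_eq0; apply/eqP.
  transitivity ((s - t) * (s ^+ 2 + t ^+ 2 + s * t - 3)); first by ring.
  by rewrite p q; ring.
transitivity ((s ^+ 2 - t ^+ 2) * (s ^+ 2 + t ^+ 2 - 4)); first by ring.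
by rewrite q; ring.
Qed.

(** The chords of [A] and [C] are linked. Making [A] the double point, [C] classical and everything
    else virtual, the index of [A] is its linking with [C], nonzero by transversality. *)
Lemma singular_diagram_exists : exists (S : sdiagram R) (x : R * R),
  double_points S = [set x] /\ gauss_index S x != 0.
Proof.
have [X [Y [X' [Y' [eX eY dX dY [far near' pos]]]]]] := @trefoil_exists R.
pose f (t : R) : plane R := (X t, Y t).
have df t : derive1 f t = (X' t, Y' t) by apply: derive1_pair.
have nr t : -2 <= t -> t <= 2 -> [/\ X t = (t ^+ 3 - 3 * t) / 9,
    Y t = t ^+ 4 - 4 * t ^+ 2, X' t = (t ^+ 2 - 1) / 3 & Y' t = 4 * t ^+ 3 - 8 * t].
  by move=> t1 t2; apply: near'; rewrite ler_norml t1 t2.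
have X2 : X 2 = 2 / 9.
  by have [|| -> _ _ _] := nr 2; [lra|lra|field].
have XN2 : X (- 2) = - (2 / 9).
  by have [|| -> _ _ _] := nr (- 2); [lra|lra|field].
have Xr s t : 2 <= s -> s < t -> X s < X t.
  move=> s2 st; apply: (increasing_gt st dX) => u /andP[su _]; apply: pos.
  by rewrite ler_normr; apply/orP; left; lra.
have Xl s t : t <= -2 -> s < t -> X s < X t.
  move=> s2 st; apply: (increasing_gt st dX) => u /andP[_ ut]; apply: pos.
  by rewrite ler_normr; apply/orP; right; lra.
(* The bounds are [X (-2)] and [X 2], through the factorizations of [t^3 - 3 t + 2] and of
   [2 - 3 t^3 / 3 + 3 t - 2 t^3 / 2 + t^3], the latter being [2 + 3 t - t^3]. *)
have Xm t : -2 <= t -> t <= 2 -> - (2 / 9) <= X t <= 2 / 9.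
  move=> t1 t2; have [-> _ _ _] := nr t t1 t2; apply/andP; split.
    have : 0 <= (t + 2) * (t - 1) ^+ 2 by rewrite mulr_ge0 ?sqr_ge0//; lra.
    lra.
  have : 0 <= (2 - t) * (t + 1) ^+ 2 by rewrite mulr_ge0 ?sqr_ge0//; lra.
  lra.
(* Outside [[-2, 2]] the abscissa is increasing and leaves the range it has on [[-2, 2]], so double
   points occur only where the curve is polynomial. *)
have inner s t : s < t -> X s = X t -> -2 <= s /\ t <= 2.
  move=> st e; have [s1|s1] := leP (-2) s.
    split=> //; have [//|t1] := leP t 2.
    have h := Xr 2 t (lexx _) t1.
    have [s2|s2] := leP s 2; first by have /andP[_ ?] := Xm s s1 s2; lra.
    by have := Xr s t (ltW s2) st; rewrite e ltxx.
  have h := Xl s (-2) (lexx _) s1.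
  have [t1|t1] := leP t (-2); first by have := Xl s t t1 st; rewrite e ltxx.
  have [t2|t2] := leP t 2; first by have /andP[? _] := Xm t (ltW t1) t2; lra.
  by have := Xr 2 t (lexx _) t2; lra.
have alg s t : s < t -> f s = f t -> [/\ -2 <= s, t <= 2 &
    (s = - t /\ t ^+ 2 = 3) \/ (s * t = -1 /\ s ^+ 2 + t ^+ 2 = 4)].
  move=> st [e1 e2]; have [s1 t1] := inner s t st e1; split => //.
  have [E1 E2 _ _] := nr s s1 (ltW (lt_le_trans st t1)).
  have [F1 F2 _ _] := nr t (ltW (le_lt_trans s1 st)) t1.
  apply: trefoil_double_points => //; last by rewrite -E2 -F2.
  by move: e1; rewrite E1 F1 => e1; lra.
pose a : R := Num.sqrt 2; pose b : R := Num.sqrt 6; pose c : R := Num.sqrt 3.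
have a0 : 0 < a by rewrite sqrtr_gt0.
have b0 : 0 < b by rewrite sqrtr_gt0.
have c0 : 0 < c by rewrite sqrtr_gt0.
have a2 : a ^+ 2 = 2 by rewrite sqr_sqrtr.
have b2 : b ^+ 2 = 6 by rewrite sqr_sqrtr.
have c2 : c ^+ 2 = 3 by rewrite sqr_sqrtr.
have ab : a < b by rewrite ltr_sqrt; lra.
(* The squares are centered at rational approximations of the roots of 2 and 6. The bound keeps the
   passage times of [A] and [C] within [[-2, 2]]. *)
have ab4 : a + b <= 4.
  have := sqr_ge0 (a - 3 / 2); have := sqr_ge0 (b - 5 / 2); lra.
pose A : R * R := ((- b - a) / 2, (b - a) / 2).
pose B : R * R := (- c, c).
pose C : R * R := ((a - b) / 2, (a + b) / 2).
have cABC (x : R * R) : crossings f x -> [\/ x = A, x = B | x = C].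
  case: x => s t [/= st /(alg _ _ st)[_ _ h]].
  exact: trefoil_parameters h.
have vertex_crossing (x : R * R) : -2 <= x.1 -> x.1 < x.2 -> x.2 <= 2 ->
    x.1 * x.2 = -1 -> x.1 ^+ 2 + x.2 ^+ 2 = 4 -> crossings f x.
  move=> x1 x12 x2 p q; split => //; rewrite /f.
  have [-> -> _ _] := nr x.1 x1 (ltW (lt_le_trans x12 x2)).
  have [-> -> _ _] := nr x.2 (ltW (le_lt_trans x1 x12)) x2.
  by have [-> ->] := trefoil_vertex p q.
have cA : crossings f A.
  apply: vertex_crossing; rewrite /A /=; [lra|lra|lra| |].
    by transitivity ((a ^+ 2 - b ^+ 2) / 4); [field|rewrite a2 b2; field].
  by transitivity ((a ^+ 2 + b ^+ 2) / 2); [field|rewrite a2 b2; field].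
have cC : crossings f C.
  apply: vertex_crossing; rewrite /C /=; [lra|lra|lra| |].
    by transitivity ((a ^+ 2 - b ^+ 2) / 4); [field|rewrite a2 b2; field].
  by transitivity ((a ^+ 2 + b ^+ 2) / 2); [field|rewrite a2 b2; field].
have tr (x : R * R) : crossings f x -> det2 (derive1 f x.1) (derive1 f x.2) != 0.
  case: x => s t [/= st /(alg _ _ st)[s1 t1 h]].
  rewrite !df /det2 /=.
  have [_ _ -> ->] := nr s s1 (ltW (lt_le_trans st t1)).
  have [_ _ -> ->] := nr t (ltW (le_lt_trans s1 st)) t1.
  exact: trefoil_transverse.
have li : long_immersion f.
  split.
  - exact: elementary_smooth.
  - move=> t; rewrite df; apply/eqP => -[x0 y0].
    have [t2|t2] := leP 2 `|t|; first by have := pos t t2; rewrite x0 ltxx.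
    have [_ _ E F] := near' t (ltW t2); move: x0 y0; rewrite E F => x0 y0.
    have h : t ^+ 2 = 1 by lra.
    have t0 : t = 0.
      have : 4 * t ^+ 3 - 8 * t = 4 * t * (t ^+ 2) - 8 * t by ring.
      by rewrite h y0 => ?; lra.
    by move: h; rewrite t0; lra.
  - by exists 3 => t /far[e1 e2]; rewrite /f e1 e2.
  - apply: (@sub_finite_set _ _ ([set A] `|` ([set B] `|` [set C]))).
      by move=> x /cABC[->|->|->]; [left|right; left|right; right].
    by rewrite !finite_setU; do !split; exact: finite_set1.
  - exact: tr.
  (* At each of the three possible crossings the earlier time is negative and the later one
     positive, so no time can be the middle one of a triple point. *)
  - move=> s t u st tu [e1 e2].
    have t_gt0 : 0 < t.
      by case: (cABC (s, t) (conj st e1)) => -[_ ->]; lra.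
    have t_lt0 : t < 0.
      by case: (cABC (t, u) (conj tu e2)) => -[-> _]; lra.
    by have := lt_trans t_gt0 t_lt0; rewrite ltxx.
have nAC : C <> A by case; lra.
pose S : sdiagram R := Diagram li (fun x =>
  if x == A then DoublePoint
  else if x == C then Ordinary Over else Ordinary Virtual).
have dC : deco S C = Ordinary Over.
  change ((if C == A then DoublePoint
    else if C == C then Ordinary Over else Ordinary Virtual) = Ordinary Over).
  by rewrite (introF eqP nAC) eqxx.
exists S, A; split.
  apply/seteqP; split => x; rewrite /double_points /=.
    by case=> _; case: eqP => // _; case: eqP.
  by move=> ->; rewrite eqxx.
have -> : gauss_index S A = linking S A C.
  rewrite -(@fsbig_set1 _ 0 +%R _ C (linking S A)); apply/esym/fsbig_widen.
    by move=> x ->.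
  move=> x [cx /= /eqP/negbTE nx].
  have [->|nA] := eqVneq x A; first exact: linking_self.
  by rewrite /linking /= (negbTE nA) nx mulr0.
rewrite /linking between_out; last by right; rewrite /A /C /=; lra.
rewrite between_in ?sub0r; [|by rewrite /A /C /=; lra..].
rewrite dC mulr1 mulN1r oppr_eq0.
by rewrite /crossing_orient /orient sgz_eq0; exact: tr.
Qed.

End TrefoilDiagram.

Theorem proposition9 (R : realType) (cat : category) :
  vassiliev_order_one cat (@ordered_polynomial R cat).
Proof.
split; first exact: vassiliev_order_le_one.
have [S [x [dS i0]]] := @singular_diagram_exists R.
exact: (vassiliev_not_order_le_zero dS i0).
Qed.
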